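(* There is no algorithm which, given two timed automata $\mathcal{A}$ and $\mathcal{B}$, decides whether the shuffle $L(\mathcal{A})\Join L(\mathcal{B})$ is timed regular.
   Context: $\mathcal{R}$ denotes the set of positive reals. A (finite) timed word over a finite alphabet $\Sigma$ is a sequence $t_1.a_1\ldots t_n.a_n$ with $t_i\in\mathcal{R}$, $a_i\in\Sigma$, i.e. an element of the free monoid $(\mathcal{R}\times\Sigma)^\star$. A timed automaton (Alur–Dill) has finitely many real-valued clocks, finitely many states with initial and final states, and finitely many transitions each labelled by a letter of $\Sigma$ (no $\varepsilon$-transitions), carrying a diagonal-free clock guard (Boolean combination of constraints $x\sim c$, $c$ a nonnegative integer) and a set of clocks to reset; $L(\mathcal{A})$ is the set of timed words accepted by final states. A timed language is timed regular if it equals $L(\mathcal{A})$ for some timed automaton $\mathcal{A}$. The shuffle of two elements $x,y$ of a monoid is the set of all products $x_1y_1x_2y_2\cdots x_ny_n$ with $x=x_1\cdots x_n$, $y=y_1\cdots y_n$; for sets, $R_1\Join R_2=\bigcup\{x\Join y: x\in R_1, y\in R_2\}$. *)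

(* Defs.v *)
From HB Require Import structures.
From mathcomp Require Import all_boot all_order all_algebra.
From mathcomp Require Import classical_sets reals.

Set Implicit Arguments.
Unset Strict Implicit.
Unset Printing Implicit Defensive.

Import Order.TTheory GRing.Theory Num.Theory.
Local Open Scope ring_scope.
Local Open Scope classical_set_scope.

Inductive cmp := CLt | CLe | CEq | CGe | CGt.

Inductive guard (m : nat) :=
| GTrue
| GAtom of 'I_m & cmp & nat
| GNot of guard m
| GAnd of guard m & guard m
| GOr of guard m & guard m.

Record transition (k n m : nat) := Transition {
  tr_src : 'I_n;
  tr_letter : 'I_k;
  tr_guard : guard m;
  tr_reset : seq 'I_m;
  tr_tgt : 'I_n }.

(* Timed automata over the alphabet 'I_k; the sets of initial states, of final
   states and of reset clocks are given by lists of their elements. *)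
Record timed_automaton (k : nat) := TimedAutomaton {
  ta_states : nat;
  ta_clocks : nat;
  ta_init : seq 'I_ta_states;
  ta_final : seq 'I_ta_states;
  ta_trans : seq (transition k ta_states ta_clocks) }.

Section Semantics.
Variable R : realType.

(* The word t_1.a_1 ... t_n.a_n; t_i is the delay elapsed before a_i. *)
Definition timed_word (k : nat) (w : seq (R * 'I_k)) : bool :=
  all (fun ta => 0 < ta.1) w.

Definition cmp_sem (c : cmp) (x y : R) : bool :=
  match c with
  | CLt => x < y
  | CLe => x <= y
  | CEq => x == y
  | CGe => y <= x
  | CGt => y < x
  end.

Fixpoint guard_sem (m : nat) (v : 'I_m -> R) (g : guard m) : bool :=
  match g with
  | GTrue => true
  | GAtom x o c => cmp_sem o (v x) c%:R
  | GNot g1 => ~~ guard_sem v g1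
  | GAnd g1 g2 => guard_sem v g1 && guard_sem v g2
  | GOr g1 g2 => guard_sem v g1 || guard_sem v g2
  end.

Definition elapse (m : nat) (v : 'I_m -> R) (t : R) : 'I_m -> R :=
  fun x => v x + t.

Definition reset (m : nat) (v : 'I_m -> R) (X : seq 'I_m) : 'I_m -> R :=
  fun x => if x \in X then 0 else v x.

(* [accepts_from A q v w]: some run of A over w that starts in state q with
   clock valuation v ends in a final state. *)
Fixpoint accepts_from (k : nat) (A : timed_automaton k) (q : 'I_(ta_states A))
    (v : 'I_(ta_clocks A) -> R) (w : seq (R * 'I_k)) : bool :=
  match w with
  | [::] => q \in ta_final A
  | (t, a) :: w' =>
      has (fun e => [&& tr_src e == q, tr_letter e == a,
                        guard_sem (elapse v t) (tr_guard e)
                      & accepts_from (tr_tgt e)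
                          (reset (elapse v t) (tr_reset e)) w'])
          (ta_trans A)
  end.

Definition ta_lang (k : nat) (A : timed_automaton k) : set (seq (R * 'I_k)) :=
  [set w | timed_word w /\
           has (fun q => accepts_from q (fun _ => 0) w) (ta_init A)].

Definition timed_regular (k : nat) (L : set (seq (R * 'I_k))) : Prop :=
  exists A : timed_automaton k, L = ta_lang A.

End Semantics.

Arguments ta_lang R {k} A.

(* x = x_1 ... x_n, y = y_1 ... y_n and z = x_1 y_1 ... x_n y_n. *)
Definition shuffle_word (T : Type) (x y : seq T) : set (seq T) :=
  [set z | exists xs ys : seq (seq T),
     [/\ size xs = size ys, x = flatten xs, y = flatten ys
       & z = flatten [seq p.1 ++ p.2 | p <- zip xs ys]]].

Definition shuffle (T : Type) (L1 L2 : set (seq T)) : set (seq T) :=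
  [set z | exists x y, [/\ L1 x, L2 y & shuffle_word x y z]].

Inductive move := MoveL | MoveN | MoveR.

(* Algorithms are deterministic Turing machines reading a binary word, with one
   two-way infinite tape. [tm_verdict q = None] means that q is not a
   halting state, [tm_verdict q = Some b] that the machine halts in q with
   answer b. *)
Record turing_machine := TuringMachine {
  tm_state : finType;
  tm_sym : finType;
  tm_blank : tm_sym;
  tm_input : bool -> tm_sym;
  tm_input_inj : injective tm_input;
  tm_input_blank : forall b, tm_input b != tm_blank;
  tm_start : tm_state;
  tm_verdict : tm_state -> option bool;
  tm_delta : tm_state -> tm_sym -> tm_state * tm_sym * move }.

(* The tape holds rev c_left ++ c_head :: c_right, surrounded by blanks. *)
Record tm_config (M : turing_machine) := TMConfig {
  c_state : tm_state M;
  c_left : seq (tm_sym M);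
  c_head : tm_sym M;
  c_right : seq (tm_sym M) }.

Definition tm_init (M : turing_machine) (w : seq bool) : tm_config M :=
  let u := [seq tm_input M b | b <- w] in
  TMConfig (tm_start M) [::] (head (tm_blank M) u) (behead u).

Definition tm_step (M : turing_machine) (c : tm_config M) : tm_config M :=
  let: TMConfig q l a r := c in
  if tm_verdict q is Some _ then c else
  let: (q', b, d) := tm_delta q a in
  match d with
  | MoveL => TMConfig q' (behead l) (head (tm_blank M) l) (b :: r)
  | MoveN => TMConfig q' l b r
  | MoveR => TMConfig q' (b :: l) (head (tm_blank M) r) (behead r)
  end.

Definition tm_answers (M : turing_machine) (w : seq bool) (b : bool) : Prop :=
  exists n, tm_verdict (c_state (iter n (@tm_step M) (tm_init M w))) = Some b.

(* M halts on the code of every instance, with the correct answer. *)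
Definition tm_decides (M : turing_machine) (I : Type) (code : I -> seq bool)
    (P : I -> Prop) : Prop :=
  forall i, exists b : bool, tm_answers M (code i) b /\ (b <-> P i).

Definition algorithmically_decidable (I : Type) (code : I -> seq bool)
    (P : I -> Prop) : Prop :=
  exists M : turing_machine, tm_decides M code P.

Definition code_nat (n : nat) : seq bool := rcons (nseq n true) false.

Definition code_seq (T : Type) (e : T -> seq bool) (s : seq T) : seq bool :=
  rcons (flatten [seq true :: e x | x <- s]) false.

Definition code_ord (n : nat) (i : 'I_n) : seq bool := code_nat i.

Definition code_cmp (o : cmp) : seq bool :=
  code_nat match o with
           | CLt => 0%N | CLe => 1%N | CEq => 2%N | CGe => 3%N | CGt => 4%N
           end.

Fixpoint code_guard (m : nat) (g : guard m) : seq bool :=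
  match g with
  | GTrue => code_nat 0
  | GAtom x o c => code_nat 1 ++ code_ord x ++ code_cmp o ++ code_nat c
  | GNot g1 => code_nat 2 ++ code_guard g1
  | GAnd g1 g2 => code_nat 3 ++ code_guard g1 ++ code_guard g2
  | GOr g1 g2 => code_nat 4 ++ code_guard g1 ++ code_guard g2
  end.

Definition code_trans (k n m : nat) (e : transition k n m) : seq bool :=
  code_ord (tr_src e) ++ code_ord (tr_letter e) ++ code_guard (tr_guard e) ++
  code_seq (@code_ord m) (tr_reset e) ++ code_ord (tr_tgt e).

Definition code_ta (k : nat) (A : timed_automaton k) : seq bool :=
  code_nat (ta_states A) ++ code_nat (ta_clocks A) ++
  code_seq (@code_ord _) (ta_init A) ++ code_seq (@code_ord _) (ta_final A) ++
  code_seq (@code_trans _ _ _) (ta_trans A).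

(* Two timed automata over a common finite alphabet, which is part of the
   input. *)
Record ta_pair := TAPair {
  pair_alphabet : nat;
  pair_fst : timed_automaton pair_alphabet;
  pair_snd : timed_automaton pair_alphabet }.

Definition code_pair (p : ta_pair) : seq bool :=
  code_nat (pair_alphabet p) ++ code_ta (pair_fst p) ++ code_ta (pair_snd p).

Definition prefix_code (T : Type) (e : T -> seq bool) : Prop :=
  forall x y s t, e x ++ s = e y ++ t -> x = y /\ s = t.

Lemma code_nat_prefix : prefix_code code_nat.
Proof.
elim=> [|n IHn] [|p] s t //=; first by case.
by case=> /IHn [-> ->].
Qed.

Lemma code_seq_prefix (T : Type) (e : T -> seq bool) :
  prefix_code e -> prefix_code (code_seq e).
Proof.
move=> eP; rewrite /prefix_code /code_seq.
elim=> [|x xs IH] [|y ys] s t /=; first by case.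
- by [].
- by [].
by case; rewrite !rcons_cat -!catA => /eP [-> /IH [-> ->]].
Qed.

Lemma code_ord_prefix (n : nat) : prefix_code (@code_ord n).
Proof. by move=> i j s t /code_nat_prefix [/val_inj -> ->]. Qed.

Lemma code_cmp_prefix : prefix_code code_cmp.
Proof. by move=> [] [] s t /code_nat_prefix []. Qed.

Lemma code_guard_prefix (m : nat) : prefix_code (@code_guard m).
Proof.
elim=> [|x o c|g IHg|g IHg h IHh|g IHg h IHh] [|x' o' c'|g'|g' h'|g' h'] s t;
  rewrite /= -?catA /=; try by case.
- by move=> [] /code_ord_prefix [-> /code_cmp_prefix [-> /code_nat_prefix [-> ->]]].
- by move=> [] /IHg [-> ->].
- by move=> [] /IHg [-> /IHh [-> ->]].
- by move=> [] /IHg [-> /IHh [-> ->]].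
Qed.

Lemma code_trans_prefix (k n m : nat) : prefix_code (@code_trans k n m).
Proof.
move=> [p a g X q] [p' a' g' X' q'] s t; rewrite /code_trans /= -!catA.
move=> /code_ord_prefix [-> /code_ord_prefix [-> /code_guard_prefix [->]]].
by move=> /(code_seq_prefix (@code_ord_prefix _)) [-> /code_ord_prefix [-> ->]].
Qed.

Lemma code_ta_prefix (k : nat) : prefix_code (@code_ta k).
Proof.
move=> [n m I F D] [n' m' I' F' D'] s t; rewrite /code_ta /= -!catA.
move=> /code_nat_prefix [en /code_nat_prefix [em]].
case: n' / en I' F' D' => I' F'; case: m' / em => D'.
move=> /(code_seq_prefix (@code_ord_prefix _)) [->].
move=> /(code_seq_prefix (@code_ord_prefix _)) [->].
by move=> /(code_seq_prefix (@code_trans_prefix _ _ _)) [-> ->].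
Qed.

Lemma code_pair_inj : injective code_pair.
Proof.
move=> [k A B] [k' A' B']; rewrite /code_pair /=.
move=> /code_nat_prefix [ek]; case: k' / ek A' B' => A' B'.
move=> /code_ta_prefix [-> eB].
by have [->] := @code_ta_prefix _ B B' [::] [::] (congr1 (cat^~ [::]) eB).
Qed.

(* Main.v *)
Require Import Defs.
From HB Require Import structures.
From mathcomp Require Import all_boot all_order all_algebra.
From mathcomp Require Import boolp classical_sets reals.
From mathcomp Require Import ring lra zify.

Set Implicit Arguments.
Unset Strict Implicit.
Unset Printing Implicit Defensive.

Import Order.TTheory GRing.Theory Num.Theory.
Local Open Scope ring_scope.

(** Delays are attached to letters, so in a shuffle the first automaton [A] can
    pick scattered letters of a word and test the sum of their delays, while
    the second one [B] checks that exactly these letters are missing.  A word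
    made of blocks of fixed shape, one block per step, encodes the run of a
    machine with real registers: the delays are the register values, and a step
    is a system of linear equations between the delays of consecutive blocks.
    After a marker letter, the shuffle contains the block words violating some
    equation; words not of the shape "marker, blocks" are added by [B], which
    is harmless because a word with two markers never has that shape.

    If every block word violates an equation, the shuffle is an untimed regular
    language.  If a block word violates none, then moving the delay of the
    marker slightly yields a word of the shuffle which no timed automaton can
    tell from that block word, all durations of prefixes being non-integral; so
    the shuffle is not timed regular.

    Two registers hold the halves of a tape as fractions in a suitable base.
    The equations depend on a parameter x only through constants of guards, and
    these are coded in unary, so the code of the pair is a binary word with
    holes, filled by x ones.  The machine guesses such a word with holes, checks
    that its number (in base 4) is x, fills the holes with x ones and runs the
    alleged decision procedure on the result.  When x is the number of the
    template of the pair itself, the procedure is run on the code of the pair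
    simulating it, and its answer is wrong. *)

(** * Languages with finitely many residuals *)

(** Regularity in the style of Myhill and Nerode: words with the same image in the finite set have
    the same residual. As [f] is an arbitrary function, closure properties require no automaton. *)
Definition recognizable (T : Type) (P : seq T -> Prop) : Prop :=
  exists (Q : finType) (f : seq T -> Q),
    forall u v, f u = f v -> forall s, P (u ++ s) -> P (v ++ s).

Section Recognizable.
Variable T : eqType.
Implicit Types (P : seq T -> Prop) (u v s w : seq T).

Lemma recognizable_ext P P' :
  (forall u, P u <-> P' u) -> recognizable P -> recognizable P'.
Proof.
move=> PP' [Q [f fP]]; exists Q, f => u v /fP uv s.
by rewrite -!PP'; exact: uv.
Qed.

Lemma recognizable_not P : recognizable P -> recognizable (fun u => ~ P u).
Proof.
move=> [Q [f fP]]; exists Q, f => u v uv s nP Pv.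
by apply: nP; apply: fP Pv.
Qed.

Lemma recognizable_and P P' :
  recognizable P -> recognizable P' -> recognizable (fun u => P u /\ P' u).
Proof.
move=> [Q [f fP]] [Q' [f' fP']]; exists (Q * Q')%type, (fun u => (f u, f' u)).
move=> u v [/fP uv /fP' uv'] s [Pu Pu']; split; [exact: uv|exact: uv'].
Qed.

Lemma recognizable_or P P' :
  recognizable P -> recognizable P' -> recognizable (fun u => P u \/ P' u).
Proof.
move=> /recognizable_not rP /recognizable_not rP'.
apply: recognizable_ext (recognizable_not (recognizable_and rP rP')) => u.
by rewrite -not_orP; split=> [/contrapT|H /(_ H)].
Qed.

Lemma recognizable_mem (a : T) : recognizable (fun u => a \in u).
Proof.
exists bool, (fun u => a \in u) => u v uv s.
by rewrite !mem_cat uv.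
Qed.

Lemma recognizable_false : recognizable (fun _ : seq T => False).
Proof. by exists unit, (fun=> tt). Qed.

Lemma recognizable_exists_mem (C : eqType) (cs : seq C) (P : C -> seq T -> Prop) :
  (forall c, recognizable (P c)) ->
  recognizable (fun u => exists2 c, c \in cs & P c u).
Proof.
move=> rP; elim: cs => [|c cs IH].
  by apply: recognizable_ext recognizable_false => u; split=> // -[].
apply: recognizable_ext (recognizable_or (rP c) IH) => u; split.
  case=> [Pc|[d dcs Pd]]; first by exists c; rewrite ?mem_head.
  by exists d; rewrite // inE dcs orbT.
move=> [d]; rewrite inE => /predU1P[->|dcs] Pd; [by left|].
by right; exists d.
Qed.

(** A prefix of [w] is determined by its length, and all other words share the empty residual. *)
Lemma recognizable_singleton w : recognizable (fun u => u = w).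
Proof.
exists (option 'I_(size w).+1),
  (fun u => if prefix u w then Some (inord (size u)) else None) => u v + s uw.
have pu : prefix u w by rewrite -uw prefix_prefix.
rewrite pu; case: ifP => // pv [] /(congr1 val) /=.
rewrite !inordK ?ltnS ?size_prefix // => uv; suff -> : v = u by [].
by move/prefixP: pv => [v' ev]; move/eqP: ev; rewrite -uw eqseq_cat // => /andP[/eqP].
Qed.

(** Levi's lemma. *)
Lemma cat_eq_cat (w1 w2 u s : seq T) : w1 ++ w2 = u ++ s ->
  (exists2 v, u = w1 ++ v & w2 = v ++ s) \/ (exists2 v, w1 = u ++ v & s = v ++ w2).
Proof.
elim: w1 u => [|a w1 IH] [|b u] /=.
- by move=> ->; left; exists [::].
- by move=> ->; left; exists (b :: u).
- by move=> <-; right; exists (a :: w1).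
move=> [-> /IH [[v -> ->]|[v -> ->]]]; [left|right]; by exists v.
Qed.

(** A subset construction: besides the class of [u], one records the classes of all suffixes that
    remain after a prefix in [P]. The cut between the two factors falls inside [u] or inside its
    continuation. *)
Lemma recognizable_cat P P' : recognizable P -> recognizable P' ->
  recognizable (fun u => exists u1 u2, [/\ u = u1 ++ u2, P u1 & P' u2]).
Proof.
move=> [Q [f fP]] [Q' [f' fP']].
exists (Q * {set Q'})%type, (fun u =>
  (f u, [set q | `[< exists u1 u2, [/\ u = u1 ++ u2, P u1 & f' u2 = q] >]])).
move=> u v [fuv /setP suv] s [w1 [w2 [uw Pw1 Pw2]]].
have [[z uz wz]|[z wz sz]] := cat_eq_cat (esym uw).
  have := suv (f' z); rewrite !inE.
  have -> : `[< exists u1 u2, [/\ u = u1 ++ u2, P u1 & f' u2 = f' z] >] = true.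
    by apply/asboolP; exists w1, z.
  move=> /esym/asboolP[v1 [v2 [-> Pv1 v2z]]].
  by exists v1, (v2 ++ s); rewrite catA; split=> //; apply: fP' (esym v2z) _ _; rewrite -wz.
exists (v ++ z), w2; split=> //; first by rewrite -catA -sz.
by apply: fP fuv _ _; rewrite -wz.
Qed.


End Recognizable.

Definition chain (E : Type) (init fin : pred E) (next : rel E) (es : seq E) : bool :=
  if es is e :: s then [&& init e, path next e s & fin (last e s)] else false.

(** It suffices to know the last letter and whether the letters so far form an admissible path. *)
Lemma recognizable_chain (E : finType) (init fin : pred E) (next : rel E) :
  recognizable (chain init fin next).
Proof.
exists (option (bool * E)), (fun es =>
  if es is e :: s then Some (init e && path next e s, last e s) else None).
move=> [|e u] [|d v] // [uv el] s /=; rewrite !cat_path !last_cat.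
by rewrite el 3!andbA uv -!andbA.
Qed.

Section Substitution.
Variables (E : finType) (T : eqType) (b : E -> seq T).
Let blocks es := flatten [seq b e | e <- es].

Lemma flatten_split es u s : blocks es = u ++ s ->
  (exists es1 es2, [/\ es = es1 ++ es2, u = blocks es1 & s = blocks es2]) \/
  (exists es1 e es2 i, [/\ es = es1 ++ e :: es2, (i < size (b e))%N,
     u = blocks es1 ++ take i (b e) & s = drop i (b e) ++ blocks es2]).
Proof.
elim: es u s => [|e es IH] u s.
  rewrite /blocks /=; case: u => //= <-.
  by left; exists [::], [::].
rewrite /blocks /= -/(blocks es) => /cat_eq_cat[[v -> /IH]|[v ev ->]].
  case=> [[es1 [es2 [-> -> ->]]]|[es1 [e' [es2 [i [-> ie -> ->]]]]]].
    by left; exists (e :: es1), es2; rewrite /blocks.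
  by right; exists (e :: es1), e', es2, i; rewrite /blocks /= catA.
case: v ev => [|a v] ev.
  by left; exists [:: e], es; rewrite /blocks /= ev !cats0.
right; exists [::], e, es, (size u).
rewrite ev take_size_cat // drop_size_cat // size_cat /=; split=> //.
by rewrite addnS ltnS leq_addr.
Qed.

(** The first set of classes serves words that end between two blocks, the second one words that end
    inside a block, which is recorded with the number of its letters already read. *)
Lemma recognizable_substitution (P : seq E -> Prop) : recognizable P ->
  recognizable (fun u => exists2 es, u = blocks es & P es).
Proof.
move=> [Q [f fP]]; pose K := \max_e size (b e).
exists ({set Q} * {set Q * E * 'I_K})%type, (fun u =>
  ([set q | `[< exists2 es, u = blocks es & f es = q >]],
   [set x : Q * E * 'I_K |
      `[< exists2 es, u = blocks es ++ take x.2 (b x.1.2) & f es = x.1.1 >]])).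
move=> u v [/setP fuv /setP guv] s [es /esym/flatten_split].
case=> [[es1 [es2 [-> eu ->]]] Pes|[es1 [e [es2 [i [-> ie eu ->]]]]] Pes].
  have := fuv (f es1); rewrite !inE.
  have -> : `[< exists2 es, u = blocks es & f es = f es1 >] by apply/asboolP; exists es1.
  move=> /esym/asboolP[es1' -> e1]; exists (es1' ++ es2).
    by rewrite /blocks map_cat flatten_cat.
  by apply: fP Pes.
have iK : (i < K)%N by apply: leq_trans ie _; exact: leq_bigmax.
have := guv (f es1, e, Ordinal iK); rewrite !inE /=.
have -> : `[< exists2 es, u = blocks es ++ take i (b e) & f es = f es1 >].
  by apply/asboolP; exists es1.
move=> /esym/asboolP[es1' -> e1]; exists (es1' ++ e :: es2).
  by rewrite /blocks map_cat flatten_cat /= -catA (catA (take _ _)) cat_take_drop.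
by apply: fP Pes.
Qed.

End Substitution.

Section UntimedAutomaton.
Variables (R : realType) (k : nat).

(** An automaton without clocks whose states are the classes of [f], with a transition whenever some
    word of the source class extends into the target class. Which word is used is harmless, since
    words of one class have the same residual. *)
Lemma recognizable_timed_regular (P : seq 'I_k -> Prop) : recognizable P ->
  exists B : timed_automaton k, forall w : seq (R * 'I_k),
    ta_lang R B w <-> timed_word w /\ P [seq ta.2 | ta <- w].
Proof.
move=> [Q [f fP]].
pose step (x : Q * 'I_k * Q) :=
  `[< exists2 u, f u = x.1.1 & f (rcons u x.1.2) = x.2 >].
pose B := @TimedAutomaton k #|Q| 0 [:: enum_rank (f [::])]
  [seq enum_rank q | q <- enum Q & `[< exists2 u, f u = q & P u >]]
  [seq Transition (enum_rank x.1.1) x.1.2 (GTrue 0) [::] (enum_rank x.2)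
    | x <- enum {: Q * 'I_k * Q} & step x].
have acc (w : seq (R * 'I_k)) q v : @accepts_from R k B (enum_rank q) v w ->
    exists2 u, f u = q & P (u ++ [seq ta.2 | ta <- w]).
  elim: w q v => [|[t a] w IH] q v /=.
    move=> /mapP[q']; rewrite mem_filter => /andP[/asboolP[u uq Pu] _].
    by move/enum_rank_inj => ->; exists u; rewrite ?cats0.
  rewrite has_map => /hasP[[[p a'] p']]; rewrite mem_filter /step /=.
  move=> /andP[/asboolP[u /= up uap] _] /and3P[/eqP/enum_rank_inj pq /eqP aa].
  move=> /IH[u' u'p' Pu']; exists u; first by rewrite up.
  by rewrite -cat_rcons -aa; apply: fP Pu'; rewrite uap.
have acc' u v (w : seq (R * 'I_k)) : P (u ++ [seq ta.2 | ta <- w]) ->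
    @accepts_from R k B (enum_rank (f u)) v w.
  elim: w u v => [|[t a] w IH] u v /=.
    rewrite cats0 => Pu; apply/mapP; exists (f u) => //.
    by rewrite mem_filter mem_enum andbT; apply/asboolP; exists u.
  rewrite -cat_rcons => /IH au; rewrite has_map; apply/hasP.
  exists (f u, a, f (rcons u a)).
    by rewrite mem_filter mem_enum andbT; apply/asboolP; exists u.
  by rewrite /= !eqxx au.
exists B => w; split=> [[tw]|[tw Pw]]; rewrite /=.
  by rewrite orbF => /acc[u u0 Pu]; split=> //; exact: (fP u [::] u0 _ Pu).
by split=> //; rewrite /= orbF; exact: (acc' [::]).
Qed.

End UntimedAutomaton.

(** * Regions, shuffles and sums of delays *)

Definition duration (R : realType) (k : nat) (w : seq (R * 'I_k)) : R :=
  \sum_(ta <- w) ta.1.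

Section Regions.
Variable R : realType.

(** Guards are diagonal-free, so they see each clock value only up to this relation. *)
Definition same_region (a b : R) : Prop :=
  forall c : nat, (a < c%:R) = (b < c%:R) /\ (c%:R < a) = (c%:R < b).

Lemma cmp_sem_region o (a b : R) (c : nat) :
  same_region a b -> cmp_sem o a c%:R = cmp_sem o b c%:R.
Proof.
move=> /(_ c)[lt_ab gt_ab]; case: o => //=; rewrite ?[_ == c%:R]eq_le ?leNgt.
all: by rewrite ?lt_ab ?gt_ab.
Qed.

Lemma guard_sem_region m (v v' : 'I_m -> R) g :
  (forall x, v x = v' x \/ same_region (v x) (v' x)) ->
  guard_sem v g = guard_sem v' g.
Proof.
move=> vv'; elim: g => //= [x o c|g -> //|g -> h -> //|g -> h -> //].
by have [->//|] := vv' x; apply: cmp_sem_region.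
Qed.

(** The same transitions can fire from both valuations: a clock not yet reset has grown by the
    duration of a prefix when it is tested, and after a reset the two values coincide. *)
Lemma accepts_from_region k (A : timed_automaton k) q (v v' : _ -> R) w :
  (forall x, v x = v' x \/ forall i, (i < size w)%N ->
     same_region (v x + duration (take i.+1 w)) (v' x + duration (take i.+1 w))) ->
  @accepts_from R k A q v w = accepts_from q v' w.
Proof.
elim: w q v v' => // -[t a] w IH q v v' vv' /=.
apply: eq_has => e; do 2!congr andb; congr andb.
  apply: guard_sem_region => x; case: (vv' x) => [xx|/(_ 0%N isT)].
    by left; rewrite /elapse xx.
  by rewrite /duration /= take0 big_seq1 /elapse; right.
apply: IH => x; rewrite /reset; case: ifP => _; first by left.
case: (vv' x) => [xx|reg]; first by left; rewrite /elapse xx.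
right=> i iw; have := reg i.+1 iw.
by rewrite /duration [take i.+2 _]/= big_cons /elapse !addrA.
Qed.

(** Each [f] has a positive distance to the least integer strictly above it, and finitely many such
    distances have a positive minimum. *)
Lemma region_gap (F : seq R) : (forall f, f \in F -> 0 <= f) ->
  exists2 h : R, 0 < h &
    forall f, f \in F -> forall c : nat, c%:R <= f \/ f + h <= c%:R.
Proof.
elim: F => [|f F IH] F0; first by exists 1.
have [|h h0 hF] := IH; first by move=> g gF; apply: F0; rewrite inE gF orbT.
have f0 : 0 <= f by apply: F0; rewrite mem_head.
have /andP[nf fn] := truncn_itv f0.
pose n := Num.truncn f; pose h' := n.+1%:R - f.
exists (Num.min h h').
  by rewrite lt_min h0 subr_gt0.
move=> g; rewrite inE => /predU1P[->|gF] c.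
  have [cn|nc] := leqP c n; [left|right].
    by apply: le_trans nf; rewrite ler_nat.
  apply: (@le_trans _ _ (f + h')); first by rewrite lerD2l ge_min lexx orbT.
  by rewrite /h' addrC subrK ler_nat.
have [cg|gc] := hF g gF c; [by left|right].
by apply: le_trans gc; rewrite lerD2l ge_min lexx.
Qed.

(** All clocks start at 0, so lengthening the first delay by [e] amounts to starting all clocks at
    [e]; [accepts_from_region] compares these two starts. *)
Lemma shift_first_delay k (A : timed_automaton k) (t e : R) a w :
  (forall i, same_region (t + duration (take i w)) (t + e + duration (take i w))) ->
  0 < t -> 0 < e ->
  ta_lang R A ((t, a) :: w) <-> ta_lang R A ((t + e, a) :: w).
Proof.
move=> reg t0 e0; rewrite /ta_lang /= /timed_word /= t0 addr_gt0 //.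
suff -> : has (fun q => accepts_from q (fun=> 0) ((t, a) :: w)) (ta_init A) =
  has (fun q => accepts_from q (fun=> 0) ((t + e, a) :: w)) (ta_init A) by [].
apply: eq_has => q; transitivity (accepts_from q (fun=> e) ((t, a) :: w)).
  apply: accepts_from_region => x; right=> i _.
  rewrite /duration /= big_cons add0r /= addrA [e + t]addrC; exact: reg.
rewrite /=; apply: eq_has => d.
suff -> : elapse (fun=> e) t = elapse (fun _ : 'I_(ta_clocks A) => 0) (t + e) by [].
by apply/funext => x; rewrite /elapse add0r addrC.
Qed.

End Regions.

Section Shuffle.
Variable T : Type.
Implicit Types x y z : seq T.

Lemma shuffle_word_cat x y z x' y' z' :
  shuffle_word x y z -> shuffle_word x' y' z' ->
  shuffle_word (x ++ x') (y ++ y') (z ++ z').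
Proof.
move=> [xs [ys [exy -> -> ->]]] [xs' [ys' [exy' -> -> ->]]].
exists (xs ++ xs'), (ys ++ ys').
by rewrite !size_cat !flatten_cat zip_cat // map_cat flatten_cat exy exy'.
Qed.

Lemma shuffle_word0l y : shuffle_word [::] y y.
Proof. by exists [:: [::]], [:: y]; rewrite /= cats0. Qed.

Lemma shuffle_word0r x : shuffle_word x [::] x.
Proof. by exists [:: x], [:: [::]]; rewrite /= !cats0. Qed.

Lemma shuffle_word_map_filter (S : Type) (f : S -> T) (p : pred S) s :
  shuffle_word (map f (filter p s)) (map f (filter (predC p) s)) (map f s).
Proof.
elim: s => [|a s IH] /=; first exact: shuffle_word0l.
case: (p a) => /=.
  exact: (shuffle_word_cat (shuffle_word0r [:: f a]) IH).
exact: (shuffle_word_cat (shuffle_word0l [:: f a]) IH).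
Qed.

Lemma shuffle_word_mask x y z : shuffle_word x y z ->
  exists2 mu : bitseq, size mu = size z &
    x = mask mu z /\ y = mask (map negb mu) z.
Proof.
move=> [xs [ys [sz -> -> ->]]]; elim: xs ys sz => [|x' xs IH] [|y' ys] //.
  by exists [::].
move=> [/IH] [mu smu [ex ey]].
exists (nseq (size x') true ++ nseq (size y') false ++ mu).
  by rewrite /= !size_cat !size_nseq smu addnA.
rewrite /= !map_cat !map_nseq /= -!catA !mask_cat ?size_nseq //.
by rewrite !mask_true // !mask_false /= -ex -ey.
Qed.

Lemma all_shuffle_word (p : pred T) x y z :
  shuffle_word x y z -> all p z = all p x && all p y.
Proof.
move=> [xs [ys [sz -> -> ->]]]; elim: xs ys sz => [|x' xs IH] [|y' ys] // [/IH].
by rewrite /= !all_cat => ->; rewrite -!andbA; congr andb; rewrite andbCA.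
Qed.

End Shuffle.

(** * An automaton detecting a wrong sum of delays *)

Section ViolationAutomaton.
Variables (k : nat) (m : 'I_k) (W : Type) (wins : seq W).
Variables (letters : W -> seq 'I_k) (cond : W -> bool * nat).

Let n := size wins.
Let win (i : 'I_n) := tnth (in_tuple wins) i.
Let L := (\max_i size (letters (win i)))%N.
Let state := option ('I_n * 'I_L.+1).

(** State [Some (i, j)] means that window [i] was guessed and [j] of its letters were read; [None]
    is initial, and final so as to accept the empty word. The clock is reset at the marker unless
    the flag in [cond] asks for the delay of the marker to be counted, and it is tested only at the
    last letter. *)
Definition violation_automaton : timed_automaton k :=
  @TimedAutomaton k #|{: state}| 1 [:: enum_rank (None : state)]
    (enum_rank (None : state) ::
     [seq enum_rank (Some (i, inord (size (letters (win i)))) : state) | i <- enum 'I_n])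
    ([seq Transition (enum_rank (None : state)) m (GTrue 1)
            (if (cond (win i)).1 then [::] else [:: ord0])
            (enum_rank (Some (i, ord0) : state)) | i <- enum 'I_n] ++
     [seq Transition (enum_rank (Some p : state)) (nth m (letters (win p.1)) p.2)
            (if p.2.+1 == size (letters (win p.1))
             then GNot (GAtom ord0 CEq (cond (win p.1)).2) else GTrue 1)
            [::] (enum_rank (Some (p.1, inord p.2.+1) : state))
     | p : 'I_n * 'I_L.+1 <- enum {: 'I_n * 'I_L.+1} & (p.2 < size (letters (win p.1)))%N]).

Variable R : realType.

Let size_letters i : (size (letters (win i)) < L.+1)%N.
Proof. by rewrite ltnS; apply: (leq_bigmax i). Qed.

Let accepts_tail (i : 'I_n) (j : 'I_L.+1) v (w : seq (R * 'I_k)) :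
  (j <= size (letters (win i)))%N ->
  @accepts_from R k violation_automaton (enum_rank (Some (i, j) : state)) v w <->
  [seq ta.2 | ta <- w] = drop j (letters (win i)) /\
  ((j < size (letters (win i)))%N -> v ord0 + duration w <> (cond (win i)).2%:R).
Proof.
elim: w j v => [|[t a] w IH] j v ji.
  split=> [|[dr _]] /=.
    rewrite inE => /orP[/eqP/enum_rank_inj//|/mapP[i' _ /enum_rank_inj[-> ->]]].
    by rewrite inordK // ltnn drop_size.
  have {dr} : (size (letters (win i)) <= j)%N.
    by rewrite -subn_eq0 -size_drop -dr.
  move=> ij; rewrite inE; apply/orP; right; apply/mapP; exists i; rewrite ?mem_enum //.
  congr (enum_rank (Some (i, _))); apply/val_inj; rewrite /= inordK //.
  by apply/eqP; rewrite eqn_leq ij ji.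
rewrite /= has_cat !has_map.
split.
  move=> /orP[/hasP[i' _ /andP[/eqP/enum_rank_inj//]]|].
  move=> /hasP[[i' j']]; rewrite mem_filter => /andP[/= ji' _].
  move=> /and4P[/eqP/enum_rank_inj[ii jj] /eqP <- g]; move: ji' g; rewrite {}ii {}jj => ji' g.
  have jL : (j.+1 < L.+1)%N by apply: leq_ltn_trans ji' (size_letters i).
  move=> /IH; rewrite inordK // => -[]// wd vw; split.
    by rewrite wd -drop_nth.
  move=> _; move: vw g wd; rewrite /duration big_cons /= /elapse addrA.
  case: eqP => [sz _|/eqP sz vw _ _]; last by apply: vw; rewrite ltn_neqAle sz.
  rewrite sz drop_size; case: w {IH} => // /eqP ne _.
  by rewrite big_nil addr0.
move=> [aw vw]; have ji' : (j < size (letters (win i)))%N.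
  by rewrite ltnNge; apply/negP => /drop_oversize; rewrite -aw.
have jL : (j.+1 < L.+1)%N by apply: leq_ltn_trans ji' (size_letters i).
move: aw; rewrite (drop_nth m) // => -[-> wd].
apply/orP; right; apply/hasP; exists (i, j); first by rewrite mem_filter ji' mem_enum.
rewrite /= !eqxx /=; apply/andP; split.
  case: eqP => //= sz; apply/eqP => /= vt; apply: (vw ji').
  move: wd; rewrite sz drop_size; case: w {IH vw} => // _.
  by rewrite /duration big_seq1.
apply/IH; rewrite inordK //; split=> // _.
by have := vw ji'; rewrite /duration big_cons addrA /reset.
Qed.

(** The test sits on the last letter of a window, whence the assumption that windows have
    letters. *)
Lemma violation_automatonE (w : seq (R * 'I_k)) :
  (forall i : 'I_n, letters (win i) <> [::]) ->
  ta_lang R violation_automaton w <->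
  timed_word w /\
  (w = [::] \/ exists (i : 'I_n) t w', [/\ w = (t, m) :: w',
     [seq ta.2 | ta <- w'] = letters (win i) &
     (if (cond (win i)).1 then t else 0) + duration w' <> (cond (win i)).2%:R]).
Proof.
move=> nnil; rewrite /ta_lang /= orbF; split=> -[tw].
  move=> acc; split=> //; case: w tw acc => [|[t a] w] tw; first by left.
  rewrite /= has_cat !has_map => /orP[]; last first.
    by move=> /hasP[[i j] _ /= /andP[/eqP/enum_rank_inj]].
  move=> /hasP[i _ /and4P[_ /eqP <- _]] /accepts_tail[]//.
  rewrite drop0 => wl vw; right; exists i, t, w; split=> //.
  have : (0 < size (letters (win i)))%N by rewrite lt0n size_eq0; apply/eqP/nnil.
  by move=> /vw; rewrite /reset /elapse /=; case: (cond _).1; rewrite ?inE /= ?add0r.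
case=> [ew|[i [t [w' [ew wl vw]]]]]; move: tw; rewrite {w}ew => tw; split=> //.
  by rewrite /= mem_head.
rewrite /= has_cat !has_map; apply/orP; left; apply/hasP.
exists i; first by rewrite -enumT mem_enum.
rewrite /= !eqxx; apply/accepts_tail => //; rewrite drop0; split=> // _.
by move: vw; rewrite /reset /elapse /=; case: (cond _).1; rewrite ?inE /= ?add0r.
Qed.

End ViolationAutomaton.

(** * Block words *)

(** Both factorisations cut the word before the first element satisfying [h], or at its end. *)
Lemma cat_eq_separated (T : Type) (h : pred T) (a a' c c' : seq T) :
  all (predC h) a -> all (predC h) a' ->
  (if c is x :: _ then h x else true) -> (if c' is x :: _ then h x else true) ->
  a ++ c = a' ++ c' -> a = a' /\ c = c'.
Proof.
move=> + + hc hc'; elim: a a' => [|x a IH] [|x' a'] //=.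
- by move=> _ /andP[nx _] ec; move: hc; rewrite ec (negbTE nx).
- by move=> /andP[nx _] _ ec; move: hc'; rewrite -ec (negbTE nx).
by move=> /andP[_ na] /andP[_ na'] [-> /(IH _ na na')[-> ->]].
Qed.

Lemma mask_negb_filter (T : eqType) (s : seq T) (p : pred T) (mu : bitseq) :
  uniq s -> size mu = size s ->
  mask (map negb mu) s = filter (predC p) s -> mu = map p s.
Proof.
elim: s mu => [|a s IH] [|b mu] //= /andP[nas us] [sz].
case: b; case: (p a) => /= sub.
- by rewrite (IH mu).
- by move: nas; rewrite (mem_mask (m := map negb mu)) // sub mem_head.
- suff : a \in filter (predC p) s by rewrite mem_filter (negbTE nas) andbF.
  by rewrite -sub mem_head.
by case: sub => /IH->.
Qed.

Section BlockSystem.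
Variables E S : finType.

Definition letter : finType := option (E * option S).
Definition alphabet_size := #|{: letter}|.
Definition marker : 'I_alphabet_size := enum_rank (None : letter).
Definition header (e : E) : 'I_alphabet_size := enum_rank (Some (e, None) : letter).
Definition slot (x : E * S) : 'I_alphabet_size :=
  enum_rank (Some (x.1, Some x.2) : letter).

Definition is_header (a : 'I_alphabet_size) : bool :=
  if enum_val a is Some (_, None) then true else false.

Lemma slot_inj : injective slot.
Proof. by move=> [e s] [e' s'] /enum_rank_inj[-> ->]. Qed.

Lemma header_inj : injective header.
Proof. by move=> e e' /enum_rank_inj[->]. Qed.

Lemma is_header_header e : is_header (header e).
Proof. by rewrite /is_header enum_rankK. Qed.

Lemma is_header_slot x : is_header (slot x) = false.
Proof. by rewrite /is_header enum_rankK. Qed.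

Lemma marker_header e : (marker == header e) = false.
Proof. by apply/eqP => /enum_rank_inj. Qed.

Lemma marker_slot x : (marker == slot x) = false.
Proof. by apply/eqP => /enum_rank_inj. Qed.

(* A window lists consecutive instructions, each with the slots that the
   automaton summing the delays takes out of the block of that instruction. *)
Definition window := seq (E * {set S}).

Definition block (e : E) := header e :: [seq slot (e, s) | s <- enum S].
Definition hole_block (p : E * {set S}) :=
  header p.1 :: [seq slot (p.1, s) | s <- enum S & s \notin p.2].
Definition hole (W : window) := flatten [seq hole_block p | p <- W].
Definition removed (W : window) : seq (E * S) :=
  flatten [seq [seq (p.1, s) | s <- enum S & s \in p.2] | p : E * {set S} <- W].
Definition pad (es : seq E) : window := [seq (e, finset.set0) | e <- es].

Lemma hole_pad es : hole (pad es) = flatten [seq block e | e <- es].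
Proof.
rewrite /hole /pad -map_comp; congr flatten; apply: eq_map => e /=.
rewrite /hole_block /block /=; congr cons; congr map.
by rewrite (@eq_filter _ _ predT) ?filter_predT // => s; rewrite inE.
Qed.

Lemma hole_cat W W' : hole (W ++ W') = hole W ++ hole W'.
Proof. by rewrite /hole map_cat flatten_cat. Qed.

Lemma removed_cat W W' : removed (W ++ W') = removed W ++ removed W'.
Proof. by rewrite /removed map_cat flatten_cat. Qed.

Lemma removed_pad es : removed (pad es) = [::].
Proof.
elim: es => // e es IH; rewrite /removed /= -/(removed (pad es)) IH cats0.
by rewrite (@eq_filter _ _ pred0) ?filter_pred0 // => s; rewrite inE.
Qed.

Lemma marker_hole W : marker \notin hole W.
Proof.
apply/negP => /flatten_mapP[p _]; rewrite inE marker_header /=.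
by move=> /mapP[s _ /eqP]; rewrite marker_slot.
Qed.

Section Timed.
Variable R : realType.
Implicit Types (rs : seq (E * (option S -> R))) (W : window).

Definition timed_slots (b : E * (option S -> R)) (X : {set S}) :=
  [seq (b.2 (Some s), slot (b.1, s)) | s <- enum S & s \in X].
Definition timed_block (b : E * (option S -> R)) :=
  (b.2 None, header b.1) :: [seq (b.2 (Some s), slot (b.1, s)) | s <- enum S].
Definition timed_blocks rs := flatten [seq timed_block b | b <- rs].
Definition timed_removed rs W :=
  flatten [seq timed_slots q.1 q.2.2 | q <- zip rs W].

Lemma timed_blocksE rs :
  [seq ta.2 | ta <- timed_blocks rs] = flatten [seq block e | e <- unzip1 rs].
Proof.
rewrite /timed_blocks map_flatten -!map_comp; congr flatten; apply: eq_map => b /=.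
by rewrite /timed_block /= -map_comp.
Qed.

Lemma timed_blocksP (w : seq (R * 'I_alphabet_size)) es :
  [seq ta.2 | ta <- w] = flatten [seq block e | e <- es] ->
  exists2 rs, unzip1 rs = es & w = timed_blocks rs.
Proof.
elim: es w => [|e es IH] w /=; first by case: w => // _; exists [::].
case: w => [//|[t a] w] /= [-> ew].
pose n := size (enum S).
have [rs <- ers] : exists2 rs, unzip1 rs = es & drop n w = timed_blocks rs.
  by apply: IH; rewrite map_drop ew drop_size_cat // size_map.
pose t1 := take n w.
have et1 : [seq ta.2 | ta <- t1] = [seq slot (e, s) | s <- enum S].
  by rewrite map_take ew take_size_cat // size_map.
(* The delay of slot [s] is found at the rank of [s] in [enum S], and [None] stands for the header;
   the default of [nth] is never reached. *)
pose rho o := if o is Some s then (nth (0, marker) t1 (index s (enum S))).1 else t.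
exists ((e, rho) :: rs) => //.
rewrite /timed_blocks /= -/(timed_blocks rs) -ers /timed_block /=.
congr cons; rewrite -{1}(cat_take_drop n w); congr cat; rewrite -/t1.
have st1 : size t1 = n by rewrite -(size_map snd) et1 size_map.
apply: (@eq_from_nth _ (0, marker)); first by rewrite size_map.
move=> i it1; have iS : (i < size (enum S))%N by rewrite -/n -st1.
have [s0 _] : exists s : S, true by case: (enum S) iS => [//|s0]; exists s0.
rewrite (nth_map s0) //= index_uniq ?enum_uniq //.
have := congr1 (fun l => nth marker l i) et1.
rewrite (nth_map (0, marker)) // (nth_map s0) // => <-.
by case: (nth _ _ _).
Qed.

Lemma mask_timed_blocks rs W mu :
  size mu = size (timed_blocks rs) ->
  [seq ta.2 | ta <- mask (map negb mu) (timed_blocks rs)] = hole W ->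
  ~~ has (fun ta => is_header ta.2) (mask mu (timed_blocks rs)) ->
  unzip1 rs = unzip1 W /\ mask mu (timed_blocks rs) = timed_removed rs W.
Proof.
elim: rs W mu => [|[e rho] rs IH] W mu.
  by case: mu => // _; case: W.
rewrite /timed_blocks /= -/(timed_blocks rs).
case: mu => [//|b mu] [/=]; rewrite size_cat size_map.
set lts := [seq (rho (Some s), slot (e, s)) | s <- enum S]; set n := size (enum S) => sz.
have nmu : (n <= size mu)%N by rewrite sz leq_addr.
have := cat_take_drop n mu.
set mu1 := take n mu; set mu2 := drop n mu => emu.
have smu1 : size mu1 = n by rewrite size_takel.
have smu2 : size mu2 = size (timed_blocks rs) by rewrite size_drop sz addKn.
have slts : size lts = n by rewrite size_map.
have sl : size mu1 = size lts by rewrite slts.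
have sl' : size (map negb mu1) = size lts by rewrite size_map.
rewrite -emu map_cat !mask_cat // {sl sl' nmu}.
clearbody mu1 mu2; clear emu sz.
case: b => /=; first by move=> _; rewrite is_header_header.
rewrite map_cat.
case: W => [//|[e' X] W]; rewrite /hole /= -/(hole W) => -[/header_inj <-].
rewrite has_cat negb_or => + /andP[_ nh2].
case/(@cat_eq_separated _ is_header).
- rewrite all_map; apply/allP => ta /mem_mask /mapP[s _ ->] /=.
  by rewrite is_header_slot.
- by rewrite all_map; apply/allP => s _ /=; rewrite is_header_slot.
- case: rs smu2 nh2 {IH} => [|b' rs]; first by case: mu2.
  by case: mu2 => [//|[] mu2] _ /=; rewrite is_header_header.
- by case: W => //= p W; rewrite is_header_header.
move=> e1 e2; have [-> ->] := IH W mu2 smu2 e2 nh2; split=> //.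
rewrite /timed_removed /=; congr cat.
suff -> : mu1 = map (mem X) (enum S).
  by rewrite /lts -map_mask -filter_mask.
apply: mask_negb_filter; rewrite ?enum_uniq //.
apply: (@inj_map _ _ (fun s => slot (e, s))); first by move=> s s' /slot_inj[].
by move: e1; rewrite /lts -map_mask -map_comp.
Qed.

Lemma shuffle_timed_blocks rs W : unzip1 rs = unzip1 W ->
  exists y, [/\ shuffle_word (timed_removed rs W) y (timed_blocks rs),
    [seq ta.2 | ta <- y] = hole W &
    [seq ta.2 | ta <- timed_removed rs W] = [seq slot x | x <- removed W]].
Proof.
elim: rs W => [|[e rho] rs IH] [|[e' X] W] //=.
  by exists [::]; split=> //; exact: shuffle_word0l.
move=> [<- /IH[y [sh yW rW]]].
exists ((rho None, header e) ::
  [seq (rho (Some s), slot (e, s)) | s <- enum S & s \notin X] ++ y); split.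
- apply: (shuffle_word_cat (shuffle_word0l [:: (rho None, header e)])).
  apply: shuffle_word_cat sh; exact: shuffle_word_map_filter.
- by rewrite /= map_cat yW /hole /= -map_comp.
rewrite /timed_removed /removed /= !map_cat rW; congr cat.
by rewrite /timed_slots -!map_comp.
Qed.

End Timed.
End BlockSystem.

(** * Regularity of the shuffle *)

Lemma shuffle_word_nil (T : Type) (y z : seq T) : shuffle_word [::] y z -> z = y.
Proof.
move=> [xs [ys [sz e0 -> ->]]].
elim: xs ys sz e0 => [|x xs IH] [|y' ys] //= [sz] /esym/nilP.
by rewrite cat_nilp => /andP[/nilP -> /nilP e0]; rewrite (IH ys).
Qed.

Section Reduction.
Variables (R : realType) (E S : finType).
Variables (init fin : pred E) (next : rel E).
Variables (wins : seq (window E S)) (cond : seq (E * S) -> bool * nat).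
Hypothesis removed_wins : forall win, win \in wins -> removed win <> [::].

Local Notation k := (alphabet_size E S).
Local Notation m := (marker E S).
Local Notation good es := (chain init fin next es).
Implicit Types (u : seq 'I_k) (z : seq (R * 'I_k)) (rs : seq (E * (option S -> R))).

Definition with_hole u : Prop :=
  exists2 win, win \in wins & exists es1 es2, u = hole (pad S es1 ++ win ++ pad S es2).

(** The first alternative supplies every ill-formed word with a marker; the second is what remains
    of a block word once the first automaton has taken the marker and the slots of a window. *)
Definition filler u : Prop :=
  (m \in u /\ ~ exists2 es, u = m :: flatten [seq block S e | e <- es] & good es) \/
  with_hole u.

Definition violated (theta : R) rs : Prop :=
  exists win es1 es2, [/\ win \in wins, unzip1 rs = es1 ++ unzip1 win ++ es2 &
    (if (cond (removed win)).1 then theta else 0) +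
    duration (timed_removed rs (pad S es1 ++ win ++ pad S es2))
      <> (cond (removed win)).2%:R].

Definition marked (theta : R) rs : seq (R * 'I_k) := (theta, m) :: timed_blocks rs.

Lemma recognizable_with_hole : recognizable with_hole.
Proof.
apply: recognizable_exists_mem => win.
have rstar : recognizable (fun u => exists2 es, u = flatten [seq block S e | e <- es] & True).
  apply: recognizable_substitution.
  by exists unit, (fun=> tt).
apply: recognizable_ext (recognizable_cat rstar (recognizable_cat
   (recognizable_singleton (hole win)) rstar)) => u; split.
  move=> [u1 [u2 [-> [es1 -> _] [u3 [u4 [-> -> [es2 -> _]]]]]]].
  by exists es1, es2; rewrite !hole_cat !hole_pad.
move=> [es1 [es2 ->]]; rewrite !hole_cat !hole_pad.
eexists _, _; split; first reflexivity; first by exists es1.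
by eexists _, _; split; first reflexivity; last by exists es2.
Qed.

Lemma recognizable_filler : recognizable filler.
Proof.
apply: recognizable_or recognizable_with_hole.
apply: recognizable_and (recognizable_mem _) _; apply: recognizable_not.
have rgood : recognizable (fun u =>
    exists2 es, u = flatten [seq block S e | e <- es] & good es).
  exact: recognizable_substitution (recognizable_chain _ _ _).
apply: recognizable_ext (recognizable_cat (recognizable_singleton [:: m]) rgood) => u.
split=> [[_ [_ [-> -> [es -> ges]]]]|[es -> ges]]; first by exists es.
by exists [:: m], (flatten [seq block S e | e <- es]); split=> //; exists es.
Qed.

Lemma marker_timed_blocks rs : m \notin [seq ta.2 | ta <- timed_blocks rs].
Proof. by rewrite timed_blocksE -hole_pad marker_hole. Qed.

Let A := violation_automaton m wins (fun win => [seq slot x | x <- removed win])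
  (fun win => cond (removed win)).

Variable B : timed_automaton k.
Hypothesis langB : forall z, ta_lang R B z <-> timed_word z /\ filler [seq ta.2 | ta <- z].

Let L := shuffle (ta_lang R A) (ta_lang R B).

Lemma langA z : ta_lang R A z <-> timed_word z /\
  (z = [::] \/ exists win t w, [/\ win \in wins, z = (t, m) :: w,
     [seq ta.2 | ta <- w] = [seq slot x | x <- removed win] &
     (if (cond (removed win)).1 then t else 0) + duration w
        <> (cond (removed win)).2%:R]).
Proof.
rewrite violation_automatonE; last first.
  move=> i; have := removed_wins (mem_tnth i (in_tuple wins)).
  by case: (removed _).
split=> -[tz]; case=> [->|]; try by split=> //; left.
  move=> [i [t [w [zw wl vw]]]]; split=> //; right.
  by exists (tnth (in_tuple wins) i), t, w; split=> //; exact: mem_tnth.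
move=> [win [t [w [winw zw wl vw]]]]; split=> //; right.
have /tnthP[i ei] : win \in in_tuple wins by [].
by exists i, t, w; rewrite -ei.
Qed.

Lemma timed_shuffle z : L z -> timed_word z.
Proof.
move=> [x [y [/langA[tx _] /langB[ty _] /all_shuffle_word sh]]].
by rewrite /timed_word sh; apply/andP.
Qed.

(** A nonempty word of the first automaton brings a marker into the shuffle, and every ill-formed
    word with a marker is itself a filler. Delays thus impose nothing here. *)
Lemma shuffle_unmarked z : timed_word z ->
  ~ (exists theta rs, good (unzip1 rs) /\ z = marked theta rs) ->
  L z <-> (m \in [seq ta.2 | ta <- z] \/ with_hole [seq ta.2 | ta <- z]).
Proof.
move=> tz nm; split.
  move=> [x [y [/langA[_ []]]]].
    by move=> -> /langB[_ yf] /shuffle_word_nil ->; case: yf => [[]|]; [left|right].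
  move=> [win [t [w [_ -> _ _]]]] _ /shuffle_word_mask[mu _ [ex _]]; left.
  apply/mapP; exists (t, m) => //; apply: (mem_mask (m := mu)).
  by rewrite -ex mem_head.
move=> Pz; exists [::], z; split; last exact: shuffle_word0l.
  by apply/langA; split=> //; left.
apply/langB; split=> //; case: Pz => [mz|]; [left|by right].
split=> // -[es ez ges]; apply: nm.
case: z ez {mz tz} => [//|[t a] z] /= [-> /timed_blocksP[rs ers ->]].
by exists t, rs; rewrite ers.
Qed.

(** The word is no filler and its only marker is at its head, so the first automaton must take that
    marker and the second one must read a word with a hole. *)
Lemma shuffle_marked theta rs : good (unzip1 rs) -> timed_word (marked theta rs) ->
  L (marked theta rs) <-> violated theta rs.
Proof.
move=> grs tz; split.
  move=> [x [y [/langA[_ []]]]].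
    move=> -> /langB[_ yf] /shuffle_word_nil ey; move: yf; rewrite -{}ey; case=> [[_ []]|].
      by exists (unzip1 rs); rewrite // /marked /= timed_blocksE.
    move=> [win _ [es1 [es2 ez]]]; have := marker_hole (pad S es1 ++ win ++ pad S es2).
    by rewrite -ez /marked /= mem_head.
  move=> [win [t [w [winw -> wl vw]]]] /langB[_ yf] /shuffle_word_mask.
  move=> [[//|b mu]] /= [smu]; case: b => /= -[]; last first.
    move=> ew; have := marker_timed_blocks rs; rewrite (map_f snd (x := (t, m))) //.
    by apply: (mem_mask (m := mu)); rewrite -ew mem_head.
  move=> [tt ew] ey; rewrite {}tt in vw.
  case: yf => [[my _]|].
    have /mapP[ta tay em] := my.
    have := marker_timed_blocks rs; rewrite em map_f //.
    by apply: (mem_mask (m := map negb mu)); rewrite -ey.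
  move=> [win' winw' [es1 [es2 yh]]].
  have [|eW xW] := mask_timed_blocks (rs := rs) smu (esym (eq_trans (esym yh) (congr1 _ ey))).
    rewrite -ew; apply/hasPn => ta /(map_f snd); rewrite wl => /mapP[es _ ->].
    by rewrite is_header_slot.
  have [y' [_ _ ]] := shuffle_timed_blocks eW.
  rewrite -xW -ew wl !removed_cat !removed_pad cats0 => /(inj_map (@slot_inj _ _)) /= rw.
  (* The hole may come from a window [win'] other than the guessed [win], but both have the same
     removed letters, on which alone the expected sum depends. *)
  exists win', es1, es2; split=> //; last by rewrite -xW -ew -rw.
  by rewrite eW /unzip1 !map_cat -!map_comp !map_id.
move=> [win [es1 [es2 [winw ers vw]]]].
pose W := pad S es1 ++ win ++ pad S es2.
have [y [sh yW rW]] : exists y, [/\ shuffle_word (timed_removed rs W) y (timed_blocks rs),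
    [seq ta.2 | ta <- y] = hole W &
    [seq ta.2 | ta <- timed_removed rs W] = [seq slot x | x <- removed W]].
  apply: shuffle_timed_blocks; rewrite ers /W /unzip1 !map_cat -!map_comp.
  by rewrite !map_id.
have {}sh : shuffle_word ((theta, m) :: timed_removed rs W) y (marked theta rs).
  exact: (shuffle_word_cat (shuffle_word0r [:: (theta, m)]) sh).
have := tz; rewrite /timed_word (all_shuffle_word _ sh) => /andP[tx ty].
exists ((theta, m) :: timed_removed rs W), y; split=> //.
  apply/langA; split=> //; right; exists win, theta, (timed_removed rs W); split=> //.
  by rewrite rW !removed_cat !removed_pad cats0.
by apply/langB; split=> //; right; exists win => //; exists es1, es2.
Qed.

(** Well-formed words then all belong to the shuffle, just as ill-formed words with a marker do, so
    membership depends on the letters only. *)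
Lemma regular_if_no_run :
  (forall theta rs, good (unzip1 rs) -> timed_word (marked theta rs) ->
     violated theta rs) ->
  timed_regular L.
Proof.
move=> norun.
have [C langC] := recognizable_timed_regular R
  (recognizable_or (recognizable_mem m) recognizable_with_hole).
exists C; apply/seteqP; split=> z.
  move=> Lz; have tz := timed_shuffle Lz; apply/langC; split=> //.
  have [[theta [rs [_ ->]]]|nm] := pselect (exists theta rs,
      good (unzip1 rs) /\ z = marked theta rs); first by left; rewrite /= mem_head.
  exact/(shuffle_unmarked tz nm).
move=> /langC[tz Pz].
have [[theta [rs [grs ez]]]|nm] := pselect (exists theta rs,
    good (unzip1 rs) /\ z = marked theta rs).
  by rewrite ez in tz *; apply/shuffle_marked => //; exact: norun.
exact/(shuffle_unmarked tz nm).
Qed.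

(* The header of the first block is unconstrained; a suitable value of it makes
   all durations of prefixes non-integral, so that [theta] can be moved. *)
Lemma not_regular_if_run theta rs :
  good (unzip1 rs) -> timed_word (marked theta rs) -> ~ violated theta rs ->
  theta < 1 -> (forall theta', theta' <> theta -> violated theta' rs) ->
  ~ timed_regular L.
Proof.
case: rs => [//|[e rho] rs] grs tz nv th1 vth [C LC].
pose rest := [seq (rho (Some s), slot (e, s)) | s <- enum S] ++ timed_blocks rs.
have ez : marked theta ((e, rho) :: rs) = (theta, m) :: (rho None, header S e) :: rest.
  by [].
have th0 : 0 < theta by move: tz => /andP[].
have trest : timed_word rest by move: tz; rewrite ez => /and3P[].
have dur0 i : 0 <= duration (take i rest).
  rewrite /duration big_seq; apply: sumr_ge0 => ta /mem_take tain.
  by have /allP/(_ _ tain)/ltW := trest.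
have [|h h0 hF] := @region_gap R (theta :: [seq theta + duration (take i rest)
    | i <- iota 0 (size rest).+1]).
  move=> f; rewrite inE => /predU1P[->|/mapP[i _ ->]]; first exact: ltW.
  by rewrite addr_ge0 // ltW.
(* The first header gets delay [tau] and the marker is moved by [d]. Since [tau + d < h], the
   durations of prefixes containing that header are strictly between consecutive integers, before
   and after the move. *)
pose tau := h / 2%:R; pose d := h / 4%:R.
have tau0 : 0 < tau by rewrite divr_gt0.
have d0 : 0 < d by rewrite divr_gt0.
have tdh : tau + d < h by rewrite /tau /d; lra.
pose rs' := (e, fun o => if o is Some _ then rho o else tau) :: rs.
(* Equations involve slots and the marker only, so the new header delay is invisible to them. *)
have vrs' t : violated t rs' <-> violated t ((e, rho) :: rs).
  split=> -[win [es1 [es2 [w1 w2 w3]]]]; exists win, es1, es2; split=> //.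
    by move: w3; case: (pad S es1 ++ _).
  by move: w3; case: (pad S es1 ++ _).
have ers' t : marked t rs' = (t, m) :: (tau, header S e) :: rest by [].
have tz' t : 0 < t -> timed_word (marked t rs').
  by move=> t0; rewrite ers' /timed_word /= t0 tau0.
have [] := @shift_first_delay R _ C theta d m ((tau, header S e) :: rest) => //.
  move=> [|i]; rewrite /duration ?take0 ?big_nil ?addr0 /=.
    (* The prefix reduced to the marker lasts [theta], which lies in (0, 1): no natural number but 0
       is below it. *)
    move=> c; have [cth|] := hF theta (mem_head _ _) c.
      have c0 : c = 0%N.
        apply/eqP; rewrite -leqn0 -ltnS -(ltr_nat R).
        exact: le_lt_trans cth th1.
      by rewrite c0 mulr0n; split; apply/idP/idP; lra.
    by rewrite /d => hc; split; apply/idP/idP; lra.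
  have : theta + duration (take i rest) \in
      theta :: [seq theta + duration (take i rest) | i <- iota 0 (size rest).+1].
    rewrite inE; apply/orP; right; apply/mapP.
    exists (minn i (size rest)); first by rewrite mem_iota /= ltnS geq_minr.
    by case: (leqP i (size rest)) => // ri; rewrite take_size take_oversize // ltnW.
  rewrite big_cons /= -/(duration _) => /hF hF' c.
  by case: (hF' c) => hc; split; apply/idP/idP; lra.
rewrite -!ers' -LC => _ back.
have td : theta + d <> theta by lra.
have : ~ L (marked theta rs').
  by move=> /shuffle_marked vL; apply: nv; apply/vrs'; apply: vL => //; exact: tz'.
apply; apply: back; apply/shuffle_marked => //; first by apply: tz'; rewrite addr_gt0.
by apply/vrs'/vth.
Qed.

End Reduction.

(** * Register machines as block words *)

Definition affine (x : nat) (c : nat * nat) : nat := (c.1 + c.2 * x)%N.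

Section Registers.
Variables (Reg E : finType) (St : eqType) (K : nat).
Variables (start : St) (src tgt : E -> St) (fin : pred E).
(* Register [r] of a block and its complement are positive delays of sum
   [bound r]; instruction [e] relates the values v, v' of [r] before and after
   by [pre e r * v + post e r * (bound r - v') = const e r]; initially
   [iweight r * v = iconst r]. *)
Variables (bound : Reg -> nat * nat) (iweight iconst : Reg -> nat).
Variables (pre post : E -> Reg -> nat) (const : E -> Reg -> nat * nat) (r0 : Reg).
Hypothesis tgt_start : forall e, tgt e != start.
Hypothesis bound_r0 : bound r0 = (1%N, 0%N).
Hypothesis K_gt0 : (0 < K)%N.
Hypothesis iweightK : forall r, (0 < iweight r <= K)%N.
Hypothesis preK : forall e r, (0 < pre e r <= K)%N.
Hypothesis postK : forall e r, (post e r <= K)%N.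

(* [inl (r, b)] is a reference copy of [r] ([b = true]) or of its complement;
   [inr (c, r, i)] is a further copy, of the complement iff [c = Some false]. *)
Definition cell : finType := ((Reg * bool) + (option bool * Reg * 'I_K))%type.
Definition cell_reg (s : cell) : Reg :=
  match s with inl (r, _) => r | inr (_, r, _) => r end.
Definition cell_sign (s : cell) : bool :=
  match s with inl (_, b) => b | inr (c, _, _) => c != Some false end.
Definition is_ref (s : cell) : bool := if s is inl _ then true else false.

Definition cells (c : option bool) (r : Reg) (n : nat) : {set cell} :=
  [set s : cell | if s is inr (c', r', i) then [&& c' == c, r' == r & (i < n)%N]
                  else false].

Definition starts (e : E) : bool := src e == start.
Definition follows (e e' : E) : bool := ~~ fin e && (tgt e == src e').

(** Every cell and the reference cell of opposite sign must add up to the bound; over all cells,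
    this makes all copies of a register equal. *)
Definition win_copy (x : E * cell) : window E cell :=
  [:: (x.1, [set x.2; inl (cell_reg x.2, ~~ cell_sign x.2)])].
Definition win_init (x : E * Reg) : window E cell :=
  [:: (x.1, cells None x.2 (iweight x.2))].
(** Sums of delays have nonnegative coefficients; the complement is what lets the new value enter
    with a negative one. *)
Definition win_step (x : E * E * Reg) : window E cell :=
  [:: (x.1.1, cells (Some true) x.2 (pre x.1.1 x.2));
      (x.1.2, cells (Some false) x.2 (post x.1.1 x.2))].
(** This equation forces the delay of the marker to be the initial value of [r0], so that moving the
    marker violates it. *)
Definition win_marker (e : E) : window E cell :=
  [:: (e, cells (Some false) r0 1)].

Definition windows : seq (window E cell) :=
  [seq win_copy x | x <- enum {: E * cell}] ++
  [seq win_init x | x <- enum {: E * Reg} & starts x.1] ++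
  [seq win_step x | x <- enum {: E * E * Reg}] ++
  [seq win_marker e | e <- enum E & starts e].

(** References are removed only in copy windows. Elsewhere the first removed letter carries a tag
    [None], [Some true] or [Some false] that reveals an initial, step or marker window; in a step
    window it is [Some true] because [pre] is positive. *)
Definition letter_sum (y : E * cell) : bool * (nat * nat) :=
  match y.2 with
  | inl (r, _) => (false, bound r)
  | inr (None, r, _) => (false, (iconst r, 0%N))
  | inr (Some true, r, _) => (false, const y.1 r)
  | inr (Some false, r, _) => (true, bound r)
  end.

(* The sum expected of removed letters has to be determined by these letters,
   since the automaton reading them does not know the window they come from. *)
Definition expected_sum (ls : seq (E * cell)) : bool * (nat * nat) :=
  if [seq y <- ls | is_ref y.2] ++ ls is y :: _ then letter_sum y
  else (false, (0%N, 0%N)).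

Lemma mem_removed1 (e : E) (X : {set cell}) y :
  (y \in removed [:: (e, X)]) = (y.1 == e) && (y.2 \in X).
Proof.
rewrite /removed /= cats0; apply/mapP/andP.
  by move=> [s]; rewrite mem_filter => /andP[sX _] ->; rewrite /= eqxx.
case: y => e' s /= [/eqP -> sX]; exists s => //.
by rewrite mem_filter sX mem_enum.
Qed.

Lemma expected_sum_ref ls c y : y \in ls -> is_ref y.2 ->
  (forall z, z \in ls -> is_ref z.2 -> letter_sum z = c) -> expected_sum ls = c.
Proof.
move=> yls ry hc; rewrite /expected_sum.
have := mem_filter (fun z : E * cell => is_ref z.2) y ls; rewrite ry yls /=.
case ef : (filter _ _) => [//|z l] _ /=.
have : z \in z :: l by rewrite mem_head.
by rewrite -ef mem_filter => /andP[rz zls]; exact: hc.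
Qed.

Lemma expected_sum_head y ls c :
  (forall z, z \in y :: ls -> ~~ is_ref z.2) -> letter_sum y = c ->
  expected_sum (y :: ls) = c.
Proof.
move=> nr yc; rewrite /expected_sum (@eq_in_filter _ _ pred0) ?filter_pred0 //.
by move=> z /nr/negbTE.
Qed.

Lemma cellsP c r n y :
  reflect (exists2 i : 'I_K, y = inr (c, r, i) & (i < n)%N) (y \in cells c r n).
Proof.
rewrite inE; apply: (iffP idP).
  by case: y => // -[[c' r'] i] /and3P[/eqP -> /eqP -> ?]; exists i.
by move=> [i -> ?]; rewrite !eqxx.
Qed.

Lemma card_cells c r n : (n <= K)%N -> #|cells c r n| = n.
Proof.
move=> nK; have -> : cells c r n =
    [set (inr (c, r, widen_ord nK i) : cell) | i : 'I_n].
  apply/setP => y; apply/cellsP/imsetP.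
    by move=> [i -> ni]; exists (Ordinal ni) => //; congr (inr (_, _, _)); exact: val_inj.
  by move=> [i _ ->]; exists (widen_ord nK i) => //=.
by rewrite card_imset ?card_ord // => i j [] /= ij; exact: val_inj.
Qed.

Lemma expected_cells (e : E) c r n W :
  (0 < n <= K)%N -> (forall z, z \in removed W -> ~~ is_ref z.2) ->
  removed ((e, cells c r n) :: W) <> [::] /\
  expected_sum (removed ((e, cells c r n) :: W)) =
  match c with
  | None => (false, (iconst r, 0%N))
  | Some true => (false, const e r)
  | Some false => (true, bound r)
  end.
Proof.
move=> /andP[n0 nK] nW; rewrite -cat1s removed_cat.
have nc z : z \in removed [:: (e, cells c r n)] -> exists i, z = (e, inr (c, r, i)).
  rewrite mem_removed1 => /andP[/eqP <- /cellsP[i zi _]]; exists i.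
  by rewrite -zi; case: z {zi}.
have : (e, inr (c, r, Ordinal (leq_trans n0 nK)) : cell) \in removed [:: (e, cells c r n)].
  rewrite mem_removed1 eqxx /=; apply/cellsP.
  by exists (Ordinal (leq_trans n0 nK)).
case: (removed [:: _]) nc => [//|y l] nc _; split=> //; rewrite cat_cons.
apply: expected_sum_head.
  move=> z; rewrite -cat_cons mem_cat => /orP[/nc[i ->]//|]; exact: nW.
have [i ->] := nc y (mem_head _ _).
by rewrite /letter_sum /=; case: c {nc} => [[]|].
Qed.

Lemma expected_copy (x : E * cell) : removed (win_copy x) <> [::] /\
  expected_sum (removed (win_copy x)) = (false, bound (cell_reg x.2)).
Proof.
case: x => e s /=.
have ref : (e, inl (cell_reg s, ~~ cell_sign s) : cell) \in removed (win_copy (e, s)).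
  by rewrite mem_removed1 eqxx !inE eqxx orbT.
split; first by move=> r0'; rewrite r0' in ref.
apply: expected_sum_ref ref isT _ => -[e' s']; rewrite mem_removed1 !inE /=.
move=> /andP[_ /orP[] /eqP ->] //.
by case: s => // -[r b].
Qed.

Lemma expected_init (x : E * Reg) : removed (win_init x) <> [::] /\
  expected_sum (removed (win_init x)) = (false, (iconst x.2, 0%N)).
Proof. exact: (@expected_cells _ None). Qed.

Lemma expected_step (x : E * E * Reg) : removed (win_step x) <> [::] /\
  expected_sum (removed (win_step x)) = (false, const x.1.1 x.2).
Proof.
apply: (@expected_cells _ (Some true)); first exact: preK.
by move=> z; rewrite mem_removed1 => /andP[_ /cellsP[i -> _]].
Qed.

Lemma expected_marker (e : E) : removed (win_marker e) <> [::] /\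
  expected_sum (removed (win_marker e)) = (true, bound r0).
Proof. exact: (@expected_cells _ (Some false)). Qed.

Lemma windows_removed win : win \in windows -> removed win <> [::].
Proof.
rewrite /windows !mem_cat => /or4P[] /mapP[x _ ->].
- by case: (expected_copy x).
- by case: (expected_init x).
- by case: (expected_step x).
- by case: (expected_marker x).
Qed.

Variables (R : realType) (x : nat).
Implicit Types sigma : Reg -> R.

Definition limit (r : Reg) : R := (affine x (bound r))%:R.
Definition in_range sigma : Prop := forall r, 0 < sigma r < limit r.
Definition initial sigma : Prop := forall r, (iweight r)%:R * sigma r = (iconst r)%:R.
Definition linked (e : E) sigma sigma' : Prop := forall r,
  (pre e r)%:R * sigma r + (post e r)%:R * (limit r - sigma' r) =
  (affine x (const e r))%:R.

Inductive halts : St -> (Reg -> R) -> Prop :=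
| halts_fin e sigma : fin e -> in_range sigma -> halts (src e) sigma
| halts_step e sigma sigma' : ~~ fin e -> in_range sigma -> linked e sigma sigma' ->
    halts (tgt e) sigma' -> halts (src e) sigma.

Definition sum_condition (ls : seq (E * cell)) : bool * nat :=
  ((expected_sum ls).1, affine x (expected_sum ls).2).

Local Notation violation := (@violated R E cell windows sum_condition).

Lemma duration_slots (b : E * (option cell -> R)) (X : {set cell}) :
  duration (timed_slots b X) = \sum_(s in X) b.2 (Some s).
Proof. by rewrite /duration /timed_slots big_map big_filter big_enum_cond. Qed.

Lemma duration_cells (b : E * (option cell -> R)) c r n v : (n <= K)%N ->
  (forall i, b.2 (Some (inr (c, r, i))) = v) ->
  duration (timed_slots b (cells c r n)) = n%:R * v.
Proof.
move=> nK bv; rewrite duration_slots (eq_bigr (fun=> v)); last first.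
  by move=> s /cellsP[i -> _]; exact: bv.
by rewrite sumr_const card_cells // mulr_natl.
Qed.

Lemma duration_copy (b : E * (option cell -> R)) (s : cell) :
  duration (timed_slots b [set s; inl (cell_reg s, ~~ cell_sign s)]) =
  b.2 (Some s) + b.2 (Some (inl (cell_reg s, ~~ cell_sign s))).
Proof.
rewrite duration_slots big_setU1 ?big_set1 // inE; apply/eqP.
by move=> /(congr1 cell_sign) /=; case: (cell_sign s).
Qed.

Lemma duration_cat k (u v : seq (R * 'I_k)) : duration (u ++ v) = duration u + duration v.
Proof. exact: big_cat. Qed.

Lemma timed_removed_cat (rs rs' : seq (E * (option cell -> R))) W W' :
  size rs = size W ->
  timed_removed (rs ++ rs') (W ++ W') = timed_removed rs W ++ timed_removed rs' W'.
Proof. by move=> sz; rewrite /timed_removed zip_cat // map_cat flatten_cat. Qed.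

Lemma timed_removed_pad (rs : seq (E * (option cell -> R))) :
  timed_removed rs (pad cell (unzip1 rs)) = [::].
Proof.
elim: rs => // b rs IH; rewrite /timed_removed /= -[flatten _]/(timed_removed rs _) IH cats0.
by rewrite /timed_slots (@eq_filter _ _ pred0) ?filter_pred0 // => s; rewrite inE.
Qed.

Lemma timed_removed_window (rs1 rw rs2 : seq (E * (option cell -> R))) win :
  unzip1 rw = unzip1 win ->
  timed_removed (rs1 ++ rw ++ rs2) (pad cell (unzip1 rs1) ++ win ++ pad cell (unzip1 rs2))
  = timed_removed rw win.
Proof.
move=> e; have sz : size rw = size win by rewrite -(size_map fst) -/(unzip1 _) e size_map.
rewrite timed_removed_cat; last by rewrite !size_map.
by rewrite timed_removed_cat // !timed_removed_pad cats0.
Qed.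

Lemma satisfied theta rs1 rw rs2 win c : ~ violation theta (rs1 ++ rw ++ rs2) ->
  win \in windows -> expected_sum (removed win) = c -> unzip1 rw = unzip1 win ->
  (if c.1 then theta else 0) + duration (timed_removed rw win) = (affine x c.2)%:R.
Proof.
move=> nv winw ec ew; apply: contrapT => ne; apply: nv.
exists win, (unzip1 rs1), (unzip1 rs2); split=> //.
  by rewrite -ew /unzip1 !map_cat.
by rewrite timed_removed_window //= ec.
Qed.

Lemma violation_split theta rs : violation theta rs ->
  exists rs1 rw rs2 win, [/\ rs = rs1 ++ rw ++ rs2, win \in windows,
    unzip1 rw = unzip1 win &
    (if (expected_sum (removed win)).1 then theta else 0) +
      duration (timed_removed rw win) <> (affine x (expected_sum (removed win)).2)%:R].
Proof.
move=> [win [es1 [es2 [winw ers ne]]]].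
pose rs1 := take (size es1) rs; pose rs' := drop (size es1) rs.
pose rw := take (size win) rs'; pose rs2 := drop (size win) rs'.
have ers1 : unzip1 rs1 = es1 by rewrite /unzip1 map_take -/(unzip1 _) ers take_size_cat.
have ers' : unzip1 rs' = unzip1 win ++ es2.
  by rewrite /unzip1 map_drop -/(unzip1 _) ers drop_size_cat.
have erw : unzip1 rw = unzip1 win.
  by rewrite /unzip1 map_take -/(unzip1 _) ers' take_size_cat // size_map.
have ers2 : unzip1 rs2 = es2.
  by rewrite /unzip1 map_drop -/(unzip1 _) ers' drop_size_cat // size_map.
have e : rs = rs1 ++ rw ++ rs2 by rewrite !cat_take_drop.
exists rs1, rw, rs2, win; split=> //.
by move: ne; rewrite {1}e -ers1 -ers2 timed_removed_window.
Qed.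

Definition reg_val (b : E * (option cell -> R)) (r : Reg) : R := b.2 (Some (inl (r, true))).

(** * From valid block words to halting computations *)

Section RunToComputation.
Variables (theta : R) (rs : seq (E * (option cell -> R))).
Hypothesis good_rs : chain starts fin follows (unzip1 rs).
Hypothesis timed_rs : timed_word (marked theta rs).
Hypothesis valid_rs : ~ violation theta rs.

(** The copy equation of [s], together with that of the positive reference to eliminate the
    complementary one. *)
Lemma copies rs1 b rs2 s : rs = rs1 ++ b :: rs2 ->
  b.2 (Some s) = if cell_sign s then reg_val b (cell_reg s)
                 else limit (cell_reg s) - reg_val b (cell_reg s).
Proof.
move=> ers.
have sat s' : b.2 (Some s') + b.2 (Some (inl (cell_reg s', ~~ cell_sign s'))) =
    limit (cell_reg s').
  have := @satisfied theta rs1 [:: b] rs2 (win_copy (b.1, s')) (false, bound (cell_reg s')).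
  rewrite /= -ers add0r /timed_removed /= cats0 duration_copy; apply=> //.
    rewrite /windows !mem_cat; apply/orP; left; apply/mapP.
    by exists (b.1, s'); rewrite ?mem_enum.
  by case: (expected_copy (b.1, s')).
have := sat s; have := sat (inl (cell_reg s, true)); rewrite /reg_val /=.
by case: (cell_sign s) => /= <-; lra.
Qed.

(** Both strict bounds express that delays are positive, for the register and for its complement. *)
Lemma reg_val_range rs1 b rs2 : rs = rs1 ++ b :: rs2 -> in_range (reg_val b).
Proof.
move=> ers r; have pos s : 0 < b.2 (Some s).
  have /andP[_ /allP/(_ (b.2 (Some s), slot (b.1, s)))] := timed_rs.
  apply; apply/flattenP; exists (timed_block b).
    by rewrite map_f // ers mem_cat mem_head orbT.
  by rewrite inE; apply/orP; right; apply/mapP; exists s; rewrite ?mem_enum.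
have := pos (inl (r, true)); have := pos (inl (r, false)).
by rewrite !(copies _ ers) /= subr_gt0 => -> ->.
Qed.

Lemma reg_val_linked rs1 b b' rs2 : rs = rs1 ++ b :: b' :: rs2 ->
  linked b.1 (reg_val b) (reg_val b').
Proof.
move=> ers r.
have := @satisfied theta rs1 [:: b; b'] rs2 (win_step (b.1, b'.1, r)) (false, const b.1 r).
rewrite /= -ers add0r /timed_removed /= cats0 duration_cat => <- //; last 2 first.
- rewrite /windows !mem_cat; apply/or4P; apply: Or43; apply/mapP.
  by exists (b.1, b'.1, r); rewrite ?mem_enum.
- by case: (expected_step (b.1, b'.1, r)).
have /andP[_ preKr] := preK b.1 r.
rewrite (duration_cells (v := reg_val b r)) //; last first.
  by move=> i; rewrite (copies _ ers).
rewrite (duration_cells (v := limit r - reg_val b' r)) //.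
move=> i; rewrite -cat_rcons in ers.
by rewrite (copies _ ers).
Qed.

Lemma run_halts : exists2 sigma, initial sigma & halts start sigma.
Proof.
have claim rs2 rs1 b : rs = rs1 ++ b :: rs2 -> path follows b.1 (unzip1 rs2) ->
    fin (last b.1 (unzip1 rs2)) -> halts (src b.1) (reg_val b).
  elim: rs2 rs1 b => [|b' rs2 IH] rs1 b ers /=.
    by move=> _ fb; apply: halts_fin fb _; exact: reg_val_range ers.
  move=> /andP[/andP[nf /eqP bb'] pb'] fl.
  apply: (halts_step nf (reg_val_range ers) (reg_val_linked ers)).
  by rewrite bb'; apply: (IH (rcons rs1 b)) pb' fl; rewrite cat_rcons.
case ers : rs => [|b rs2]; have := good_rs; rewrite ers // => /and3P[/eqP sb pb fb].
exists (reg_val b); last by rewrite -sb; exact: (claim rs2 [::] b).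
move=> r; have /andP[_ iK] := iweightK r.
have := @satisfied theta [::] [:: b] rs2 (win_init (b.1, r)) (false, (iconst r, 0%N)).
rewrite /= -ers add0r /affine /= mul0n addn0 => <- //; last 2 first.
- rewrite /windows !mem_cat; apply/or4P; apply: Or42; apply/mapP.
  by exists (b.1, r); rewrite // mem_filter mem_enum /starts sb eqxx.
- by case: (expected_init (b.1, r)).
rewrite /timed_removed /= cats0 (duration_cells (v := reg_val b r)) //.
by move=> i; rewrite (@copies [::] b rs2).
Qed.

End RunToComputation.

(** * From halting computations to valid block words *)

Section ComputationToRun.
Implicit Types (b : E * (Reg -> R)) (l : seq (E * (Reg -> R))).

Fixpoint computation l : Prop :=
  if l is b :: l' then
    [/\ in_range b.2, (if l' is b' :: _ then linked b.1 b.2 b'.2 else True)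
      & computation l']
  else True.

Lemma computation_catr l1 l2 : computation (l1 ++ l2) -> computation l2.
Proof. by elim: l1 => //= b l1 IH [_ _ /IH]. Qed.

Lemma halts_computation st sigma : halts st sigma ->
  exists b l,
  [/\ src b.1 = st, b.2 = sigma, path follows b.1 (unzip1 l),
      fin (last b.1 (unzip1 l)) & computation (b :: l)].
Proof.
elim=> [e s fe rs|e s s' nfe rs lk _ [b [l [sb bs pb fb cb]]]].
  by exists (e, s), [::].
exists (e, s), (b :: l); split=> //=; last by split=> //; rewrite bs.
by rewrite /follows nfe sb eqxx.
Qed.

(** Headers occur in no equation; their delay 1 is an arbitrary positive value. *)
Definition cell_val sigma (o : option cell) : R :=
  if o is Some s then
    if cell_sign s then sigma (cell_reg s) else limit (cell_reg s) - sigma (cell_reg s)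
  else 1.

Definition cell_block b := (b.1, cell_val b.2).

Lemma duration_cell_block b c r n : (n <= K)%N ->
  duration (timed_slots (cell_block b) (cells c r n)) =
  n%:R * (if c != Some false then b.2 r else limit r - b.2 r).
Proof.
pose s : cell := inr (c, r, Ordinal K_gt0).
by move=> nK; rewrite (@duration_cells _ _ _ _ (cell_val b.2 (Some s))).
Qed.

Lemma timed_computation l : computation l -> timed_word (timed_blocks (map cell_block l)).
Proof.
elim: l => // b l IH [rb _ /IH tl].
rewrite /timed_blocks /= -/(timed_blocks _) /timed_word /= ltr01 /= all_cat.
apply/andP; split=> //; rewrite all_map; apply/allP => s _ /=.
by have /andP[? ?] := rb (cell_reg s); case: ifP; rewrite ?subr_gt0.
Qed.

Lemma map_split (T T' : Type) (f : T -> T') (u : seq T) v1 v2 v3 :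
  map f u = v1 ++ v2 ++ v3 ->
  exists u1 u2 u3, [/\ u = u1 ++ u2 ++ u3, map f u1 = v1, map f u2 = v2 & map f u3 = v3].
Proof.
move=> e; exists (take (size v1) u), (take (size v2) (drop (size v1) u)),
  (drop (size v2) (drop (size v1) u)).
by rewrite !cat_take_drop !map_take !map_drop e take_size_cat // drop_size_cat //
  take_size_cat // drop_size_cat.
Qed.

Lemma starts_head e es1 e' es2 : path follows e (es1 ++ e' :: es2) -> ~~ starts e'.
Proof.
rewrite cat_path /= => /and3P[_ /andP[_ /eqP le] _].
by rewrite /starts -le tgt_start.
Qed.

(** The marker gets the initial value of [r0], which is below 1 because the bound of [r0] is 1; the
    marker equation at the first block excludes any other delay. *)
Lemma halts_run sigma : initial sigma -> halts start sigma ->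
  exists theta rs, [/\ chain starts fin follows (unzip1 rs),
    timed_word (marked theta rs), ~ violation theta rs, theta < 1 &
    forall theta', theta' <> theta -> violation theta' rs].
Proof.
move=> isig /halts_computation[b0 [l0 [sb0 bs0 pb0 fb0 cb0]]].
pose rs := [seq cell_block b | b <- b0 :: l0].
have urs : unzip1 rs = unzip1 (b0 :: l0) by rewrite /unzip1 -map_comp.
have lim0 : limit r0 = 1 by rewrite /limit bound_r0 /affine mul0n addn0.
have /andP[th0 th1] : 0 < sigma r0 < 1.
  by have [/(_ r0) + _ _] := cb0; rewrite bs0 lim0.
(* No instruction leads back to [start], so initial and marker windows can only be placed at the
   first block. *)
have first l1 b l2 : b0 :: l0 = l1 ++ b :: l2 -> starts b.1 -> b = b0.
  case: l1 => [[]//|b1 l1 [_ el]]; rewrite el in pb0.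
  move: pb0; rewrite /unzip1 map_cat /= => /starts_head/negbTE -> //.
exists (sigma r0), rs; split=> //.
- by rewrite urs /= /starts sb0 eqxx pb0.
- by apply/andP; split=> //; exact: (timed_computation cb0).
- move=> /violation_split[rs1 [rw [rs2 [win [ers winw ew]]]]]; apply.
  have [l1 [lw [l2 [el _ erw _]]]] := map_split ers.
  move: winw ew; rewrite -{}erw /windows !mem_cat => /or4P[] /mapP[y].
  + move=> _ ->; have [_ ->] := expected_copy y.
    case: lw el => [//|b [|//]] el [eb].
    rewrite add0r /timed_removed /= cats0 duration_copy /=.
    by case: (cell_sign _) => /=; rewrite -/(limit _); lra.
  + rewrite mem_filter => /andP[sy _] ->; have [_ ->] := expected_init y.
    case: lw el => [//|b [|//]] el [eb]; rewrite add0r /timed_removed /= cats0.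
    have /andP[_ iK] := iweightK y.2.
    rewrite duration_cell_block //= /affine mul0n addn0 -isig -bs0.
    by rewrite (first l1 b l2) // eb.
  + move=> _ ->; have [_ ->] := expected_step y.
    case: lw el => [//|b [//|b' [|//]]] el [eb eb'].
    rewrite add0r /timed_removed /= cats0 duration_cat.
    have /andP[_ pK] := preK y.1.1 y.2.
    rewrite !duration_cell_block //= -eb.
    by move: cb0; rewrite el => /computation_catr[_ /(_ y.2) -> _].
  + rewrite mem_filter => /andP[sy _] ->; have [_ ->] := expected_marker y.
    case: lw el => [//|b [|//]] el [eb]; rewrite /timed_removed /= cats0.
    rewrite duration_cell_block //= -/(limit _) (first l1 b l2) ?eb // bs0.
    by lra.
move=> theta' ne; exists (win_marker b0.1), [::], (unzip1 l0); split.
- rewrite /windows !mem_cat; apply/or4P; apply: Or44; apply: map_f.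
  by rewrite mem_filter mem_enum /starts sb0 eqxx.
- by rewrite urs.
rewrite /sum_condition; have [_ ->] := expected_marker b0.1.
have -> : unzip1 l0 = unzip1 [seq cell_block b | b <- l0] by rewrite /unzip1 -map_comp.
have := @timed_removed_window [::] [:: cell_block b0] [seq cell_block b | b <- l0]
  (win_marker b0.1) erefl.
rewrite /= => ->; rewrite /timed_removed /= cats0 duration_cell_block //= -/(limit _) lim0.
by rewrite bs0 => e; apply: ne; lra.
Qed.

End ComputationToRun.
End Registers.

(** * Simulation of a Turing machine *)

(* A template is a binary word with holes; filling its holes with x ones gives
   the code of the x-th pair of automata. *)
Definition expand (x : nat) (T : seq (option bool)) : seq bool :=
  flatten [seq if o is Some b then [:: b] else nseq x true | o <- T].

Definition template_digit (o : option bool) : nat :=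
  match o with Some false => 1 | Some true => 2 | None => 3 end.

(** The digits are 1, 2 and 3, least significant first. Without a digit 0 the number determines the
    template, and a new symbol in front acts as n -> 4 n + d. *)
Definition template_number (T : seq (option bool)) : nat :=
  foldr (fun o n => 4 * n + template_digit o)%N 0%N T.

Lemma template_number_inj : injective template_number.
Proof.
elim=> [|o T IH] [|o' T'] //=.
- by case: o' => [[]|] /=; lia.
- by case: o => [[]|] /=; lia.
move=> e; suff [-> /IH ->] : o = o' /\ template_number T = template_number T' by [].
by move: e; case: o o' => [[]|] [[]|] /=; split=> //; lia.
Qed.

(** Templates are built from the right, so the number register stays at most [x] on the way to a
    template of number [x]. *)
Lemma template_number_cat T T' : (template_number T' <= template_number (T ++ T'))%N.
Proof. by elim: T => //= o T; lia. Qed.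

Lemma natr_close (R : realType) (m n : nat) :
  m%:R < n%:R + 1 :> R -> n%:R < m%:R + 1 :> R -> m = n.
Proof.
rewrite !natr1 !ltr_nat !ltnS => mn nm.
by apply/eqP; rewrite eqn_leq mn nm.
Qed.

Section Instructions.
Variables Q A : finType.

(** [IStar] opens a hole, [IInc] puts a one into it and [IExit] closes it. The argument of [IGo] and
    the last one of [IStep] guess the symbol next under the head; when it comes from a half tape, a
    pop verifies the guess. *)
Inductive instruction :=
| IInit | IBit of bool | IStar | IInc | IExit | IGo of A | IStep of Q & A & A
| IFin of Q & A.

Definition instruction_code (e : instruction) :
  (option (option (option (option bool))) + A + (Q * A * A) + (Q * A))%type :=
  match e with
  | IInit => inl (inl (inl None))
  | IBit b => inl (inl (inl (Some (Some (Some (Some b))))))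
  | IStar => inl (inl (inl (Some None)))
  | IInc => inl (inl (inl (Some (Some None))))
  | IExit => inl (inl (inl (Some (Some (Some None)))))
  | IGo a => inl (inl (inr a))
  | IStep q a a' => inl (inr (q, a, a'))
  | IFin q a => inr (q, a)
  end.

Definition instruction_decode c : instruction :=
  match c with
  | inl (inl (inl None)) => IInit
  | inl (inl (inl (Some None))) => IStar
  | inl (inl (inl (Some (Some None)))) => IInc
  | inl (inl (inl (Some (Some (Some None))))) => IExit
  | inl (inl (inl (Some (Some (Some (Some b)))))) => IBit b
  | inl (inl (inr a)) => IGo a
  | inl (inr (q, a, a')) => IStep q a a'
  | inr (q, a) => IFin q a
  end.

Lemma instruction_codeK : cancel instruction_code instruction_decode.
Proof. by case. Qed.

HB.instance Definition _ := Finite.copy instruction (can_type instruction_codeK).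

End Instructions.

Section Program.
Variable M : turing_machine.
Local Notation Sym := (tm_sym M).
Local Notation instr := (instruction (tm_state M) (tm_sym M)).

(* [None]: initialisation; [Some None]: the template is guessed digit by digit
   and expanded onto the tape; [Some (Some None)]: ones are being pushed for a
   hole; [Some (Some (Some (q, a)))]: [M] is in state q and reads a. *)
Definition phase : eqType := option (option (option (tm_state M * tm_sym M))).
Definition Building : phase := Some None.
Definition Filling : phase := Some (Some None).
Definition Running (q : tm_state M) (a : Sym) : phase := Some (Some (Some (q, a))).

(* As in [tm_step], a halted machine stays in its configuration. *)
Definition effect (q : tm_state M) (a : Sym) : tm_state M * Sym * move :=
  if tm_verdict q is Some _ then (q, a, MoveN) else tm_delta q a.

Definition source (e : instr) : phase :=
  match e with
  | IInit => None
  | IBit _ | IStar | IGo _ => Building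
  | IInc | IExit => Filling
  | IStep q a _ | IFin q a => Running q a
  end.

Definition target (e : instr) : phase :=
  match e with
  | IInit | IBit _ | IExit => Building
  | IStar | IInc => Filling
  | IGo a => Running (tm_start M) a
  | IStep q a a' =>
      let: (q', b, d) := effect q a in Running q' (if d is MoveN then b else a')
  | IFin q a => Running q a
  end.

Definition final (e : instr) : bool :=
  if e is IFin q _ then tm_verdict q == Some true else false.

(** The first component is [true] for the number registers: [number] holds the number of the
    template, [counter] the ones pushed for the current hole. *)
Definition register : finType := (bool * bool)%type.
Definition left_tape : register := (false, false).
Definition right_tape : register := (false, true).
Definition number : register := (true, false).
Definition counter : register := (true, true).

(** [Subtract] takes off x. A stored natural number v has delay v + 1 < x + 2, and v + 1 - x must be
    positive, so this is possible only for v = x: it is an equality test. *)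
Inductive operation :=
| Keep | Push of tm_sym M | Pop of tm_sym M | Append of nat | Increment | Subtract.

Definition operation_of (e : instr) (r : register) : operation :=
  match e with
  | IBit b =>
      match r with
      | (false, true) => Push (tm_input M b)
      | (true, false) => Append (template_digit (Some b))
      | _ => Keep
      end
  | IStar => if r is (true, false) then Append (template_digit None) else Keep
  | IInc =>
      match r with
      | (false, true) => Push (tm_input M true)
      | (true, true) => Increment
      | _ => Keep
      end
  | IExit => if r is (true, true) then Subtract else Keep
  | IGo a =>
      match r with
      | (false, true) => Pop a
      | (true, false) => Subtract
      | _ => Keep
      end
  | IStep q a a' =>
      let: (_, b, d) := effect q a in
      match d, r with
      | MoveL, (false, false) => Pop a'
      | MoveL, (false, true) => Push b
      | MoveR, (false, false) => Push b
      | MoveR, (false, true) => Pop a'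
      | _, _ => Keep
      end
  | _ => Keep
  end.

(** The margin 4 keeps digits strictly between 0 and [base - 2], and makes the weight 4 of [Append]
    at most [base]. *)
Definition base : nat := (#|{: Sym}| + 4)%N.
Definition digit (a : Sym) : nat := (enum_rank a).+1.

(* Tape registers are fractions in (0, 1); a number register holding v has
   delay v + 1 and complement x + 1 - v, where x is the parameter. *)
Definition bounds (r : register) : nat * nat :=
  if r.1 then (2%N, 1%N) else (1%N, 0%N).
Definition init_weight (r : register) : nat := if r.1 then 1%N else base.-1.
Definition init_const (r : register) : nat := if r.1 then 1%N else digit (tm_blank M).
Definition pre_weight (e : instr) (r : register) : nat :=
  match operation_of e r with Pop _ => base | Append _ => 4%N | _ => 1%N end.
Definition post_weight (e : instr) (r : register) : nat :=
  if operation_of e r is Push _ then base else 1%N.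
(** The constants absorb the bound and the offset 1. For [Append d] on delays u and u', the equation
    4 u + (x + 2 - u') = 5 - d + x says u' - 1 = 4 (u - 1) + d. *)
Definition step_const (e : instr) (r : register) : nat * nat :=
  match operation_of e r with
  | Keep => bounds r
  | Push a => ((base - digit a)%N, 0%N)
  | Pop a => ((digit a).+1, 0%N)
  | Append d => ((5 - d)%N, 1%N)
  | Increment => (1%N, 1%N)
  | Subtract => (2%N, 2%N)
  end.

Lemma digit_lt a : (0 < digit a < base.-2)%N.
Proof.
rewrite /digit /base; have : (enum_rank a < #|{: Sym}|)%N by exact: ltn_ord.
by move: (nat_of_ord _) => i; move: #|_| => n; lia.
Qed.

Lemma digit_inj : injective digit.
Proof. by move=> a b [] /val_inj/enum_rank_inj. Qed.

Lemma target_start e : target e != None.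
Proof. by case: e => //= q a a'; case: (effect q a) => [[]]. Qed.

Lemma init_weight_base r : (0 < init_weight r <= base)%N.
Proof. by rewrite /init_weight /base; case: r.1; lia. Qed.

Lemma pre_weight_base e r : (0 < pre_weight e r <= base)%N.
Proof. by rewrite /pre_weight /base; case: (operation_of e r) => *; lia. Qed.

Lemma post_weight_base e r : (post_weight e r <= base)%N.
Proof. by rewrite /post_weight /base; case: (operation_of e r) => *; lia. Qed.

Lemma base_gt0 : (0 < base)%N.
Proof. by rewrite /base addn4. Qed.

Variables (R : realType) (x : nat).
Implicit Types sigma : register -> R.

Local Notation program_halts :=
  (halts source target final bounds pre_weight post_weight step_const x).
Local Notation program_linked := (linked bounds pre_weight post_weight step_const x).
Local Notation program_range := (@in_range _ bounds R x).
Local Notation program_initial := (initial init_weight init_const).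

Lemma limitE r : limit bounds R x r = if r.1 then x%:R + 2 else 1.
Proof.
rewrite /limit /affine /bounds; case: r.1 => /=; rewrite ?mul0n ?mul1n ?addn0 //.
by rewrite natrD addrC.
Qed.

Definition operation_sem (o : operation) (v v' : R) : Prop :=
  match o with
  | Keep => v' = v
  | Push a => base%:R * v' = (digit a)%:R + v
  | Pop a => base%:R * v = (digit a)%:R + v'
  | Append d => v' - 1 = 4 * (v - 1) + d%:R
  | Increment => v' = v + 1
  | Subtract => v' = v - x%:R
  end.

Lemma operation_typed e r :
  match operation_of e r with
  | Keep => true
  | Push _ | Pop _ => ~~ r.1
  | Append d => r.1 && (d <= 5)%N
  | _ => r.1
  end.
Proof.
case: r => -[] []; case: e => [|[]||||a|q a a'|q a] //=.
all: by case: (effect q a) => [[q' b] []].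
Qed.

Lemma linkedE e sigma sigma' : program_linked e sigma sigma' <->
  forall r, operation_sem (operation_of e r) (sigma r) (sigma' r).
Proof.
suff H r : (pre_weight e r)%:R * sigma r +
    (post_weight e r)%:R * (limit bounds R x r - sigma' r) =
    (affine x (step_const e r))%:R <->
    operation_sem (operation_of e r) (sigma r) (sigma' r).
  by split=> h r; apply/H.
rewrite limitE /affine /pre_weight /post_weight /step_const.
have := operation_typed e r; have dlt := digit_lt.
case: (operation_of e r) => [|a|a|d||]; rewrite /bounds; case: r.1 => //=;
  rewrite ?mul0n ?mul1n ?addn0 => h; rewrite ?natrB //; try by move: (dlt a); lia.
all: rewrite ?natrD ?natrM ?(natrB _ h) -?(natr1 (digit _)); split=> e'; lra.
Qed.

(** The infinite tail of blanks is a periodic expansion, of value [digit] of the blank over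
    [base - 1]; this is the equation imposed initially on the tape registers. *)
Definition tape_val (s : seq Sym) : R :=
  foldr (fun a v => ((digit a)%:R + v) / base%:R)
    ((digit (tm_blank M))%:R / base.-1%:R) s.

Lemma base_neq0 : base%:R != 0 :> R.
Proof. by rewrite pnatr_eq0 /base addn4. Qed.

Lemma base_predE : base.-1%:R = base%:R - 1 :> R.
Proof. by rewrite -subn1 natrB // /base addn4. Qed.

Lemma digit_bounds a : 1 <= ((digit a)%:R : R) <= base%:R - 2.
Proof.
have /andP[d0 db] := digit_lt a; rewrite ler1n d0 /=.
have -> : base%:R - 2 = base.-2%:R :> R by rewrite -subn2 natrB // /base addn4.
by rewrite ler_nat ltnW.
Qed.

Lemma tape_valE s : base%:R * tape_val s =
  (digit (head (tm_blank M) s))%:R + tape_val (behead s).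
Proof.
have b1 : base%:R - 1 != 0 :> R.
  by rewrite -base_predE pnatr_eq0 /base addn4.
case: s => [|a s] /=; rewrite ?base_predE; field => //.
exact: base_neq0.
Qed.

Lemma tape_val_bounds s : 0 < tape_val s < 1.
Proof.
have b4 : 4 <= base%:R :> R by rewrite (ler_nat R 4) /base addn4.
elim: s => [|a s IH] /=; rewrite ?base_predE.
  have /andP[? ?] := digit_bounds (tm_blank M).
  by rewrite divr_gt0 ?ltr_pdivrMr; lra.
move: IH => /andP[? ?]; have /andP[? ?] := digit_bounds a.
by rewrite divr_gt0 ?ltr_pdivrMr; lra.
Qed.

(** Two fractions in (0, 1) differ by less than 1, so the integer part forces the guessed symbol to
    be the actual one. *)
Lemma pop_unique a s (v : R) : base%:R * tape_val s = (digit a)%:R + v -> 0 < v < 1 ->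
  a = head (tm_blank M) s /\ v = tape_val (behead s).
Proof.
rewrite tape_valE => e v01; have vs := tape_val_bounds (behead s).
suff ea : a = head (tm_blank M) s by split=> //; move: e; rewrite ea; lra.
by apply: digit_inj; apply: (@natr_close R); lra.
Qed.

Lemma push_unique a s (v : R) :
  base%:R * v = (digit a)%:R + tape_val s -> v = tape_val (a :: s).
Proof. by move=> /= <-; rewrite mulrC mulKf // base_neq0. Qed.

(** * Correctness of the simulation *)

Lemma tm_step_effect q l a r : tm_step (@TMConfig M q l a r) =
  let: (q', b, d) := effect q a in
  match d with
  | MoveL => TMConfig q' (behead l) (head (tm_blank M) l) (b :: r)
  | MoveN => TMConfig q' l b r
  | MoveR => TMConfig q' (b :: l) (head (tm_blank M) r) (behead r)
  end.
Proof. by rewrite /effect /=; case: (tm_verdict q). Qed.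

Local Notation input w := [seq tm_input M b | b <- w].

(** The invariant of the simulation. Symbols are added in front of the template, so pushes leave its
    expansion on the right tape in reading order; during filling, [number] already counts the open
    hole. *)
Definition consistent (p : phase) sigma : Prop :=
  match p with
  | None => program_initial sigma
  | Some None => exists T, [/\ sigma left_tape = tape_val [::],
      sigma right_tape = tape_val (input (expand x T)),
      sigma number = (template_number T)%:R + 1 & sigma counter = 1]
  | Some (Some None) => exists T j, [/\ sigma left_tape = tape_val [::],
      sigma right_tape = tape_val (input (nseq j true ++ expand x T)),
      sigma number = (template_number (None :: T))%:R + 1 & sigma counter = j%:R + 1]
  | Some (Some (Some (q, a))) => exists T n l r, [/\ template_number T = x,
      iter n (@tm_step M) (tm_init M (expand x T)) = TMConfig q l a r,
      sigma left_tape = tape_val l & sigma right_tape = tape_val r]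
  end.

(** All guesses are verified by the ranges: a pop succeeds only with the right symbol, and a
    subtraction only when the register holds [x]. *)
Lemma consistent_step e sigma sigma' :
  program_range sigma -> program_range sigma' -> program_linked e sigma sigma' ->
  consistent (source e) sigma -> consistent (target e) sigma'.
Proof.
move=> rs rs' /linkedE lk.
have rangeE r : 0 < sigma r < (if r.1 then x%:R + 2 else 1) by rewrite -limitE.
have rangeE' r : 0 < sigma' r < (if r.1 then x%:R + 2 else 1) by rewrite -limitE.
have nat_eq (n : nat) : (n%:R + 1 - x%:R : R) > 0 -> (n%:R + 1 : R) < x%:R + 2 -> n = x.
  by move=> h1 h2; apply: (@natr_close R); lra.
move: (lk left_tape) (lk right_tape) (lk number) (lk counter).
case: e {lk} => [|b||||a|q a a'|q a] /=.
- move=> el er eY ec isig; exists [::].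
  have := isig number; have := isig counter; rewrite /init_weight /init_const /=.
  have tape0 r : ~~ r.1 -> sigma r = tape_val [::].
    move=> nr; have := isig r; rewrite /init_weight /init_const (negbTE nr) /= => <-.
    by rewrite mulrC mulKf // pnatr_eq0 /base addn4.
  by rewrite el er eY ec (tape0 left_tape) // (tape0 right_tape) // => hc hY; split=> //; lra.
- move=> el er eY ec [T [sl sr sY sc]]; exists (Some b :: T); split.
  + by rewrite el.
  + by apply: push_unique; rewrite er sr.
  + by rewrite /= natrD natrM; lra.
  + by rewrite ec.
- move=> el er eY ec [T [sl sr sY sc]]; exists T, 0%N.
  by rewrite el er ec add0r; split=> //; rewrite /= natrD natrM; lra.
- move=> el er eY ec [T [j [sl sr sY sc]]]; exists T, j.+1; split.
  + by rewrite el.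
  + by apply: push_unique; rewrite er sr.
  + by rewrite eY.
  + by rewrite ec sc -natr1.
- move=> el er eY ec [T [j [sl sr sY sc]]]; exists (None :: T).
  have jx : j = x.
    have /andP[h1 _] := rangeE' counter; have /andP[_ h2] := rangeE counter.
    by apply: nat_eq; rewrite -sc // -ec.
  by rewrite el er eY ec sc; split=> //; rewrite ?sr ?jx //; lra.
- move=> el er eY ec [T [sl sr sY sc]].
  have Tx : template_number T = x.
    have /andP[h1 _] := rangeE' number; have /andP[_ h2] := rangeE number.
    by apply: nat_eq; rewrite -sY // -eY.
  have [ea ev] : a = head (tm_blank M) (input (expand x T)) /\
      sigma' right_tape = tape_val (behead (input (expand x T))).
    by apply: pop_unique; [rewrite -er sr|exact: (rangeE' right_tape)].
  exists T, 0%N, [::], (behead (input (expand x T))); split=> //; last by rewrite el.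
  by rewrite /= /tm_init -ea.
- case ef : (effect q a) => [[q' b] d] + + + + [T [n [l [r [Tx it sl sr]]]]].
  have it' : iter n.+1 (@tm_step M) (tm_init M (expand x T)) =
      tm_step (TMConfig q l a r) by rewrite -it.
  move: it'; rewrite tm_step_effect ef; case: d {ef} => it' el er _ _.
  + have [ea ev] : a' = head (tm_blank M) l /\ sigma' left_tape = tape_val (behead l).
      by apply: pop_unique; [rewrite -el sl|exact: (rangeE' left_tape)].
    exists T, n.+1, (behead l), (b :: r); split=> //; first by rewrite ea.
    by apply: push_unique; rewrite er sr.
  + by exists T, n.+1, l, r; rewrite el er.
  + have [ea ev] : a' = head (tm_blank M) r /\ sigma' right_tape = tape_val (behead r).
      by apply: pop_unique; [rewrite -er sr|exact: (rangeE' right_tape)].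
    exists T, n.+1, (b :: l), (behead r); split=> //; first by rewrite ea.
    by apply: push_unique; rewrite el sl.
- by move=> el er _ _ [T [n [l [r [Tx it sl sr]]]]]; exists T, n, l, r; rewrite el er.
Qed.

Lemma halts_in_range p sigma : program_halts p sigma -> program_range sigma.
Proof. by case. Qed.

Lemma halts_sound p sigma : program_halts p sigma -> consistent p sigma ->
  exists2 T, template_number T = x & tm_answers M (expand x T) true.
Proof.
elim=> {p sigma} [[]//= q a sigma /eqP vq _ [T [n [l [r [Tx it _ _]]]]]|].
  by exists T => //; exists n; rewrite it.
move=> e sigma sigma' _ rs lk hs IH cs; apply: IH.
by apply: consistent_step cs; rewrite //; exact: halts_in_range hs.
Qed.

Definition registers (l r : seq Sym) (n c : nat) : register -> R := fun i =>
  match i with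
  | (false, false) => tape_val l
  | (false, true) => tape_val r
  | (true, false) => n%:R + 1
  | (true, true) => c%:R + 1
  end.

Lemma registers_range l r n c : (n <= x)%N -> (c <= x)%N ->
  program_range (registers l r n c).
Proof.
move=> nx cx i; rewrite limitE; case: i => -[] [] /=; rewrite ?tape_val_bounds //.
  by move: cx; rewrite -(ler_nat R); have := ler0n R c; lra.
by move: nx; rewrite -(ler_nat R); have := ler0n R n; lra.
Qed.

Lemma push_tape_val a s : base%:R * tape_val (a :: s) = (digit a)%:R + tape_val s.
Proof. exact: tape_valE. Qed.

(** Induction on the number of steps of [M]; both number registers are 0 from [IGo] on. *)
Lemma halts_running n q l a r :
  tm_verdict (c_state (iter n (@tm_step M) (TMConfig q l a r))) = Some true ->
  program_halts (Running q a) (registers l r 0 0).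
Proof.
elim: n q l a r => [|n IH] q l a r.
  move=> /= vq; apply: (@halts_fin _ _ _ source target _ _ _ _ _ _ _ (IFin q a)).
    by rewrite /= vq.
  exact: registers_range.
rewrite iterSr tm_step_effect; case ef : (effect q a) => [[q' b] d].
pose a' := match d with MoveL => head (tm_blank M) l | MoveN => b
           | MoveR => head (tm_blank M) r end.
pose l' := match d with MoveL => behead l | MoveN => l | MoveR => b :: l end.
pose r' := match d with MoveL => b :: r | MoveN => r | MoveR => behead r end.
move=> vq; have h : program_halts (Running q' a') (registers l' r' 0 0).
  by apply: IH; move: vq; rewrite /a' /l' /r'; case: d {ef a' l' r'}.
apply: (@halts_step _ _ _ source target _ _ _ _ _ _ _ (IStep q a a') _
  (registers l' r' 0 0)) => //.
- exact: registers_range.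
- apply/linkedE => i; rewrite /= ef /l' /r' /a'.
  by case: d {ef a' l' r' h vq} i => -[[] []] //=; rewrite ?push_tape_val ?tape_valE.
- by rewrite /= ef; move: h; rewrite /a'; case: (d).
Qed.

Section Complete.
Variable T : seq (option bool).
Hypothesis number_T : template_number T = x.
Hypothesis answer_T : tm_answers M (expand x T) true.

(** [T2] is the part already built. The induction shortens [T1], the part still missing, and so goes
    backwards from the moment when [M] is started. *)
Lemma halts_building T1 T2 : T = T1 ++ T2 ->
  program_halts Building (registers [::] (input (expand x T2)) (template_number T2) 0).
Proof.
elim/last_ind: T1 T2 => [|T1 o IH] T2 eT.
  have [n] := answer_T; rewrite eT /tm_init => /halts_running h.
  apply: (@halts_step _ _ _ source target _ _ _ _ _ _ _ (IGo _ _) _ _ _ _ _ h) => //.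
    by apply: registers_range; rewrite -?number_T ?eT.
  apply/linkedE => -[[] []] //=; first by rewrite -number_T eT; lra.
  exact: tape_valE.
have T2x : (template_number T2 <= x)%N.
  by rewrite -number_T eT; exact: template_number_cat.
rewrite cat_rcons in eT; have := IH _ eT.
have oT2x : (template_number (o :: T2) <= x)%N.
  by rewrite -number_T eT; exact: template_number_cat.
case: o {IH eT} oT2x => [b|] oT2x h.
  apply: (@halts_step _ _ _ source target _ _ _ _ _ _ _ (IBit _ _ b) _ _ _ _ _ h) => //.
    exact: registers_range.
  apply/linkedE => -[[] []] //=; first by rewrite natrD natrM; lra.
  exact: push_tape_val.
(* Here [j] counts the ones still to be pushed for the hole. *)
have fill j : (j <= x)%N -> program_halts Filling (registers [::]
    (input (nseq (x - j) true ++ expand x T2)) (template_number (None :: T2)) (x - j)).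
  elim: j => [|j IH] jx.
    rewrite subn0.
    apply: (@halts_step _ _ _ source target _ _ _ _ _ _ _ (IExit _ _) _ _ _ _ _ h) => //.
      exact: registers_range.
    by apply/linkedE => -[[] []] //=; lra.
  have e : (x - j = (x - j.+1).+1)%N by lia.
  have := IH (ltnW jx); rewrite {}e => h'.
  apply: (@halts_step _ _ _ source target _ _ _ _ _ _ _ (IInc _ _) _ _ _ _ _ h') => //.
    by apply: registers_range => //; lia.
  apply/linkedE => -[[] []] //=; first by rewrite -natr1.
  exact: push_tape_val.
have := fill x (leqnn x); rewrite subnn => h'.
apply: (@halts_step _ _ _ source target _ _ _ _ _ _ _ (IStar _ _) _ _ _ _ _ h') => //.
  exact: registers_range.
by apply/linkedE => -[[] []] //=; rewrite natrD natrM; lra.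
Qed.

Lemma halts_complete :
  exists2 sigma : register -> R, program_initial sigma & program_halts None sigma.
Proof.
exists (registers [::] [::] 0 0).
  have b0 : base.-1%:R != 0 :> R by rewrite pnatr_eq0 /base addn4.
  by move=> -[[] []]; rewrite /init_weight /init_const /= 1?mulrC ?divfK //; lra.
have := @halts_building T [::] (esym (cats0 T)) => h.
apply: (@halts_step _ _ _ source target _ _ _ _ _ _ _ (IInit _ _) _ _ _ _ _ h) => //.
  exact: registers_range.
by apply/linkedE => -[[] []].
Qed.

End Complete.

(** The program may guess any template, but the test of its number and injectivity leave only
    [T]. *)
Lemma program_haltsE T : template_number T = x ->
  (exists2 sigma : register -> R, program_initial sigma & program_halts None sigma) <->
  tm_answers M (expand x T) true.
Proof.
move=> Tx; split=> [[sigma isig hs]|]; last exact: halts_complete.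
have [T' T'x ans] := halts_sound hs isig.
by rewrite (template_number_inj (etrans Tx (esym T'x))).
Qed.

End Program.

(** * The fixed point *)

Definition has_template (f : nat -> seq bool) : Prop :=
  exists T, forall x, f x = expand x T.

Lemma has_template_const w : has_template (fun=> w).
Proof.
exists [seq Some b | b <- w] => x; elim: w => //= b w IH.
by rewrite {1}IH.
Qed.

Lemma has_template_cat f g : has_template f -> has_template g ->
  has_template (fun x => f x ++ g x).
Proof.
move=> [T fT] [T' gT']; exists (T ++ T') => x.
by rewrite /expand map_cat flatten_cat -/(expand x T) -fT -/(expand x T') -gT'.
Qed.

(** In unary this is [c.1] ones, then [c.2] holes, then the closing [false]. *)
Lemma has_template_affine c : has_template (fun x => code_nat (affine x c)).
Proof.
have rep (f : nat -> seq bool) n : has_template f ->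
    has_template (fun x => iter n (cat (f x)) [::]).
  move=> tf; elim: n => [|n IH] /=; first exact: has_template_const.
  exact: has_template_cat.
have tx : has_template (fun x => nseq x true).
  by exists [:: None] => x; rewrite /expand /= cats0.
have [T eT] := has_template_cat (has_template_cat (has_template_const (nseq c.1 true))
  (rep _ c.2 tx)) (has_template_const [:: false]).
exists T => x; rewrite -eT /code_nat /affine cats1 nseqD; congr (rcons (_ ++ _) _).
by elim: c.2 => //= n IH; rewrite mulSn nseqD IH.
Qed.

Lemma has_template_items (I T : Type) (e : T -> seq bool) (g : nat -> I -> T) (s : seq I) :
  (forall i, has_template (fun x => e (g x i))) ->
  has_template (fun x => flatten [seq true :: e y | y <- [seq g x i | i <- s]]).
Proof.
move=> te; elim: s => [|i s IH] /=; first exact: has_template_const.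
exact: (has_template_cat (has_template_cat (has_template_const [:: true]) (te i)) IH).
Qed.

Lemma has_template_items_cat (T : Type) (e : T -> seq bool) (s s' : nat -> seq T) :
  has_template (fun x => flatten [seq true :: e y | y <- s x]) ->
  has_template (fun x => flatten [seq true :: e y | y <- s' x]) ->
  has_template (fun x => flatten [seq true :: e y | y <- s x ++ s' x]).
Proof.
move=> ts ts'; have [t et] := has_template_cat ts ts'.
by exists t => x; rewrite map_cat flatten_cat.
Qed.

Lemma has_template_ta k n m (I F : seq 'I_n) (D : nat -> seq (transition k n m)) :
  has_template (fun x => flatten [seq true :: code_trans e | e <- D x]) ->
  has_template (fun x => code_ta (TimedAutomaton I F (D x))).
Proof.
move=> tD; rewrite -[fun x => code_ta _]/(fun x => code_nat n ++ code_nat m ++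
  code_seq (@code_ord n) I ++ code_seq (@code_ord n) F ++
  code_seq (@code_trans k n m) (D x)).
do 4![apply: has_template_cat; first exact: has_template_const].
have [T eT] := has_template_cat tD (has_template_const [:: false]).
by exists T => x; rewrite -eT /code_seq cats1.
Qed.

Lemma has_template_trans k n m p (a : 'I_k) (g : nat -> guard m) X (q : 'I_n) :
  has_template (fun x => code_guard (g x)) ->
  has_template (fun x => code_trans (Transition p a (g x) X q)).
Proof.
move=> tg; rewrite /code_trans /=.
do 2![apply: has_template_cat; first exact: has_template_const].
apply: has_template_cat tg _; exact: has_template_const.
Qed.

(** Among all parts of the automaton, only the constants of the guards on last letters vary with
    [x]. *)
Lemma violation_automaton_template k (m : 'I_k) (W : Type) (wins : seq W)
    (letters : W -> seq 'I_k) (flag : W -> bool) (coef : W -> nat * nat) :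
  has_template (fun x => code_ta (violation_automaton m wins letters
    (fun w => (flag w, affine x (coef w))))).
Proof.
apply: has_template_ta.
apply: has_template_items_cat; apply: has_template_items => i /=.
  exact: has_template_const.
apply: has_template_trans; case: (_ == _); last exact: has_template_const.
do 4![apply: has_template_cat; first exact: has_template_const].
exact: has_template_affine.
Qed.

Lemma tm_answers_fun (M : turing_machine) w b b' :
  tm_answers M w b -> tm_answers M w b' -> b = b'.
Proof.
have stop n c d : tm_verdict (c_state c) = Some d ->
    tm_verdict (c_state (iter n (@tm_step M) c)) = Some d.
  move=> vc; elim: n => //= n; case: (iter n _ c) => q l a r /= vq.
  by rewrite vq.
move=> [n vn] [n' vn'].
have := stop n' _ _ vn; have := stop n _ _ vn'; rewrite -!iterD addnC => -> [].
by move=> ->.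
Qed.

Section FixedPoint.
Variables (R : realType) (M : turing_machine).

Local Notation E := (instruction (tm_state M) (tm_sym M)).
Local Notation S := (cell register (base M)).
Local Notation cond := (sum_condition bounds (init_const M) (@step_const M)).

Definition program_windows : seq (window E S) :=
  windows (base M) (None : phase M) (@source M) (init_weight M) (@pre_weight M)
    (@post_weight M) left_tape.

Definition program_filler : seq 'I_(alphabet_size E S) -> Prop :=
  filler (starts (None : phase M) (@source M)) (@final M)
    (follows (@source M) (@target M) (@final M)) program_windows.

Variable B : timed_automaton (alphabet_size E S).
Hypothesis langB : forall z,
  ta_lang R B z <-> timed_word z /\ program_filler [seq ta.2 | ta <- z].

(** [B] is the same for all [x], as fillers do not mention the expected sums. *)
Definition pair_at (x : nat) : ta_pair :=
  TAPair (violation_automaton (marker E S) program_windows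
    (fun win => [seq slot y | y <- removed win]) (fun win => cond x (removed win))) B.

Definition shuffle_regular (p : ta_pair) : Prop :=
  timed_regular (shuffle (ta_lang R (pair_fst p)) (ta_lang R (pair_snd p))).

Lemma pair_at_template : has_template (fun x => code_pair (pair_at x)).
Proof.
apply: has_template_cat; first exact: has_template_const.
apply: has_template_cat; last exact: (has_template_const (code_ta B)).
exact: violation_automaton_template.
Qed.

Lemma pair_at_regular T : let x := template_number T in
  shuffle_regular (pair_at x) <-> ~ tm_answers M (expand x T) true.
Proof.
move=> x; rewrite -(program_haltsE M R (erefl x)).
have wins0 win : win \in program_windows -> removed win <> [::].
  exact: (windows_removed bounds (init_const M) (@step_const M) (base_gt0 M)
    (@init_weight_base M) (@pre_weight_base M)).
split=> [reg [sigma isig hs]|nh].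
  have [theta [rs [grs trs nv th1 vth]]] := halts_run (@target_start M)
    (erefl : bounds left_tape = (1%N, 0%N))
    (base_gt0 M) (@init_weight_base M) (@pre_weight_base M) (@post_weight_base M) isig hs.
  exact: (not_regular_if_run wins0 langB grs trs nv th1 vth) reg.
apply: (regular_if_no_run wins0 langB) => theta rs grs trs; apply: contrapT => nv.
apply: nh; exact: (run_halts (@init_weight_base M) (@pre_weight_base M)
  (@post_weight_base M) grs trs nv).
Qed.

End FixedPoint.

Theorem theorem5 (R : realType) :
  ~ algorithmically_decidable code_pair
      (fun p => timed_regular
                  (shuffle (ta_lang R (pair_fst p)) (ta_lang R (pair_snd p)))).
Proof.
move=> [M decM].
have [B langB] := recognizable_timed_regular R
  (recognizable_filler _ _ _ _ : recognizable (@program_filler M)).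
have [T codeT] := pair_at_template B.
(* The diagonal choice: when [x] is the number of [T], the word [expand x T] on which the program
   runs [M] is the code of the pair at [x] itself. *)
have [b [ansb]] := decM (pair_at B (template_number T)).
have := pair_at_regular langB T; rewrite /= -codeT => -[noans reg].
case: b ansb => ansb [yes no]; first exact: (noans (yes isT)).
suff : false by []; apply: no; apply: reg => anst.
by have := tm_answers_fun ansb anst.
Qed.
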